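(* Assume that the nonlocal interaction kernel $\omega_\delta$ satisfies $\int_0^\delta\frac{\omega_\delta(h)}{h}\,dh<\infty$. Then every traveling wave solution of the nonlocal model $$\frac{\partial u}{\partial t}+\int_0^\delta \frac{g(u,\tau_h u)-g(\tau_{-h}u,u)}{h}\,\omega_\delta(h)\,dh=0\quad\text{in }\mathbb{R}\times(0,T),$$ i.e. any weak solution of the form $u(x,t)=v(x-ct)$ for some $c\in\mathbb{R}$, is either stationary (i.e. $c=0$) or lies in $C^{k+1,1}$ (after modification on a null set), where $k\ge 0$ is the largest integer such that $g\in C^{k,1}$.
   Context: Fix $T>0$ and $\delta>0$. Notation: $\tau_{\pm h}u(x,t)=u(x\pm h,t)$. $C^{k,1}$ denotes the functions that are $k$ times continuously differentiable with Lipschitz continuous derivatives of order $k$. Kernel: $\omega_\delta:\mathbb{R}\to\mathbb{R}$ is integrable with $\omega_\delta\ge 0$, $\operatorname{supp}\omega_\delta\subseteq[0,\delta]$ and $\int_0^\delta\omega_\delta(h)\,dh=1$. Flux: $g:\mathbb{R}\times\mathbb{R}\to\mathbb{R}$ is consistent with a flux $f$, i.e. $g(u,u)=f(u)$; monotone, i.e. $\partial_1 g\ge 0$ and $\partial_2 g\le 0$ (nondecreasing in the first and nonincreasing in the second argument); and Lipschitz continuous, i.e. $|g(u_1,v_1)-g(u_2,v_2)|\le C(|u_1-u_2|+|v_1-v_2|)$ for all real $u_1,u_2,v_1,v_2$. Weak solution with initial datum $u_0$ (here $u_0=v$): $u\in L^\infty(\mathbb{R}\times(0,T))$ such that for all $\phi\in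 C_c^\infty(\mathbb{R}\times[0,T))$ $$\int_0^T\!\!\int_{\mathbb{R}}u\,\frac{\partial\phi}{\partial t}\,dx\,dt+\int_{\mathbb{R}}u_0(x)\phi(x,0)\,dx+\int_0^T\!\!\int_{\mathbb{R}}\int_0^\delta\frac{\tau_h\phi-\phi}{h}\,g(u,\tau_hu)\,\omega_\delta(h)\,dh\,dx\,dt=0.$$ *)

(* Defs.v *)
From HB Require Import structures.
From mathcomp Require Import all_boot all_order all_algebra.
From mathcomp Require Import all_classical all_reals all_analysis.
Set Implicit Arguments.
Unset Strict Implicit.
Unset Printing Implicit Defensive.
Import Order.TTheory GRing.Theory Num.Theory.
Import numFieldNormedType.Exports.
Local Open Scope classical_set_scope.
Local Open Scope ring_scope.

Section differentiability_classes.
Context {R : realType} {V : normedModType R}.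

Fixpoint iter_derive (vs : seq V) (f : V -> R) : V -> R :=
  if vs is v :: vs' then 'D_v (iter_derive vs' f) else f.

(* Intended for open D: the derivatives at points of D are then those of the
   restriction of f to D.  In finite dimension, existence and continuity of the
   iterated directional derivatives of order <= k is the usual C^k. *)
Definition Ck (D : set V) (k : nat) (f : V -> R) : Prop :=
  (forall vs : seq V, (size vs < k)%N ->
     forall x, D x -> forall v, derivable (iter_derive vs f) x v) /\
  (forall vs : seq V, (size vs <= k)%N ->
     forall x, D x -> {for x, continuous (iter_derive vs f)}).

Definition Ck1 (D : set V) (k : nat) (f : V -> R) : Prop :=
  Ck D k f /\
  forall vs : seq V, size vs = k ->
    exists L : R, L.-lipschitz_D (iter_derive vs f).

Definition smooth (f : V -> R) : Prop := forall k, Ck setT k f.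

End differentiability_classes.

Section nonlocal_conservation_law.
Context {R : realType}.
Implicit Types (T delta c h : R) (u phi : R * R -> R) (g : R -> R -> R).

Local Notation mu := (@lebesgue_measure R).

Definition strip T : set (R * R) := [set p | 0 < p.2 < T].

Definition tau h u : R * R -> R := fun p => u (p.1 + h, p.2).

Definition kernel_of_horizon delta (omega : R -> R) : Prop :=
  [/\ mu.-integrable setT (EFin \o omega),
      forall h, 0 <= omega h,
      closure [set h | omega h != 0] `<=` `[0, delta] &
      (\int[mu]_(h in `[0%R, delta]) (omega h)%:E = 1)%E].

Definition consistent g (f : R -> R) : Prop := forall a, g a a = f a.

Definition monotone_flux g : Prop :=
  (forall b, {homo g ^~ b : a a' / a <= a'}) /\
  (forall a, {homo g a : b b' / b <= b' >-> b' <= b}).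

Definition lipschitz_flux g : Prop :=
  exists C : R, forall a1 b1 a2 b2,
    `|g a1 b1 - g a2 b2| <= C * (`|a1 - a2| + `|b1 - b2|).

Definition Linfty_strip T u : Prop :=
  measurable_fun (strip T) u /\
  exists M : R, {ae (mu \x mu)%E, forall p, strip T p -> `|u p| <= M}.

(* C_c^oo(R x [0, T)), given by smooth functions on R^2 with compact support in
   R x (-oo, T): by Seeley extension and a cutoff in negative times, their
   restrictions to R x [0, T) are all the test functions, and the weak
   formulation involves only these restrictions. *)
Definition test_function T phi : Prop :=
  [/\ smooth phi,
      compact (closure [set p | phi p != 0]) &
      closure [set p | phi p != 0] `<=` [set p | p.2 < T]].

Definition weak_solution T delta (omega : R -> R) g (u0 : R -> R) u : Prop :=
  Linfty_strip T u /\
  forall phi, test_function T phi ->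
    (\int[mu]_(t in `]0, T[) \int[mu]_x (u (x, t) * 'D_((0, 1) : R * R) phi (x, t)))
    + \int[mu]_x (u0 x * phi (x, 0))
    + (\int[mu]_(t in `]0, T[) \int[mu]_x \int[mu]_(h in `[0, delta])
         ((tau h phi (x, t) - phi (x, t)) / h
          * g (u (x, t)) (tau h u (x, t)) * omega h)) = 0.

Definition traveling_wave (v : R -> R) c : R * R -> R :=
  fun p => v (p.1 - c * p.2).

End nonlocal_conservation_law.

(* Main.v *)
Require Import Defs.
From HB Require Import structures.
From mathcomp Require Import all_boot all_order all_algebra.
From mathcomp Require Import all_classical all_reals all_analysis.
From mathcomp Require Import measurable_realfun ring lra.
Import Order.TTheory GRing.Theory Num.Theory.
Import numFieldNormedType.Exports.
Local Open Scope classical_set_scope.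
Local Open Scope ring_scope.
Set Implicit Arguments.
Unset Strict Implicit.
Unset Printing Implicit Defensive.

(** Why the theorem holds.  Let [c <> 0] and put [kap h = omega h / h], which is
    integrable by assumption.  In the frame of the wave the equation reads
    [c v' = G], where
    [G y = int_h kap h (g (v y) (v (y + h)) - g (v (y - h)) (v y))]
    is the nonlocal flux of the profile.  Since [v] is essentially bounded and
    [kap] is integrable, [G] is bounded; so [v] is Lipschitz, up to a null set.
    Moreover [G] is as regular as [v], as long as [g] is: differentiation
    passes under the integral.  Hence the equation improves the regularity of
    [v] by one derivative at a time, from Lipschitz to C^{k+1,1} when [g] is
    C^{k,1}, and the wave inherits the regularity of its profile.

    The first part makes [c v' = G] rigorous.  The weak formulation is tested
    on products of a plateau in [x - c t], a smooth approximation of the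
    indicator of the interval from [a] to [b], with a bump in time
    ([plateau_identity]); a discrete integration by parts
    ([nonlocal_by_parts]) moves the difference quotient onto the flux.  When
    [a] and [b] are Lebesgue points of the profile, the limit of sharp
    plateaus gives [c (v b - v a) = int_a^b G].  The primitive of [G] is then a
    Lipschitz representative [w] of [v] which solves the profile equation at
    every point ([lipschitz_traveling_profile]).

    The second part is the bootstrap [profile_Ck1].  It rests on a class of
    families of C^{k,1} functions with uniform bounds ([Ck1_family]), defined
    by recursion on derivatives and stable under products, under composition
    with the flux ([Ck1_family_comp]) and under integration of the parameter
    ([Ck1_family_int]).  The representative [w] does not depend on [k], as the
    statement requires.  [Ck1_travel] transfers the result to the plane.

    Test functions need a smooth bump.  It is built from the flat functions
    [p(1/x) exp(-1/x)], with [p] a polynomial, which are stable under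
    differentiation; smoothness on the plane is obtained from an algebra of
    functions stable under directional derivatives ([smooth_class]). *)

(** * One-variable calculus *)

Section calculus.
Context {R : realType}.
Implicit Types (f df : R -> R) (x y z l C M L : R).

Lemma is_derive_growth f x l :
  is_derive x 1 f l <-> h^-1 * (f (h + x) - f x) @[h --> 0^'] --> l.
Proof.
have E : (fun h : R => h^-1 *: ((f \o shift x) (h *: 1) - f x)) =
         (fun h => h^-1 * (f (h + x) - f x)).
  by apply/funext => h /=; rewrite [h *: 1]mulr1.
split.
- move=> [df dv]; rewrite -dv -E; exact: df.
- rewrite -E => H; apply: DeriveDef.
  + by apply/cvg_ex; exists l.
  + exact: cvg_lim H.
Qed.

(** Reduces directional derivatives in the plane to the calculus of one real
    variable. *)
Lemma is_derive_line {V : normedModType R} (F : V -> R) (p v : V) (l : R) :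
  is_derive p v F l <-> is_derive (0 : R) 1 (fun h : R => F (h *: v + p)) l.
Proof.
rewrite is_derive_growth.
have E : (fun h : R => h^-1 *: ((F \o shift p) (h *: v) - F p)) =
  (fun h : R => h^-1 * (F ((h + 0) *: v + p) - F (0 *: v + p))).
  by apply/funext => h /=; rewrite addr0 scale0r add0r.
split.
- move=> [df dv]; rewrite -dv -E; exact: df.
- rewrite -E => H; apply: DeriveDef.
  + by apply/cvg_ex; exists l.
  + exact: cvg_lim H.
Qed.

(** The derivatives of two-variable composites, of integrals with a parameter,
    of flat functions at 0 and of primitives of Lipschitz functions are all
    obtained from a quadratic error bound. *)
Lemma is_derive_quadratic f x l C :
  (forall y, `|f y - f x - l * (y - x)| <= C * (y - x) ^+ 2) ->
  is_derive x 1 f l.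
Proof.
move=> H; apply/is_derive_growth; apply/cvgrPdist_le => e e0.
have C0 : 0 <= C.
  have := H (x + 1); rewrite (_ : x + 1 - x = 1) ?expr1n ?mulr1; last by ring.
  apply: le_trans.
  exact: normr_ge0.
have dd : 0 < e / (C + 1) by rewrite divr_gt0// ltr_wpDl.
near=> h.
have h0 : h != 0 by near: h; exact: nbhs_dnbhs_neq.
have -> : l - h^-1 * (f (h + x) - f x) =
          - (h^-1 * (f (h + x) - f x - l * (h + x - x))) by field.
rewrite normrN normrM normfV ler_pdivrMl ?normr_gt0//.
apply: le_trans (H _) _; rewrite addrK -real_normK ?num_real//.
rewrite expr2 mulrA mulrC ler_wpM2l//.
have : `|h| <= e / (C + 1).
  near: h; apply: dnbhs0_le => //.
rewrite ler_pdivlMr ?ltr_wpDl//; nra.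
Unshelve. all: by end_near. Qed.

Lemma mean_value f df x y : (forall z, is_derive z 1 f (df z)) ->
  exists2 c, Num.min x y <= c <= Num.max x y & f y - f x = df c * (y - x).
Proof.
move=> H.
have cf z : {for z, continuous f}.
  apply: differentiable_continuous; apply/derivable1_diffP.
  by have [] := H z.
have [xy|yx] := leP x y.
- have [c] := @MVT_segment _ f df _ _ xy (fun z _ => H z)
    (continuous_subspaceT cf).
  by rewrite in_itv/=; exists c.
- have [c] := @MVT_segment _ f df _ _ (ltW yx) (fun z _ => H z)
    (continuous_subspaceT cf).
  rewrite in_itv/= => ? e; exists c => //.
  by rewrite -opprB e; ring.
Qed.

Lemma lipschitz_derive_taylor f df L : (forall z, is_derive z 1 f (df z)) ->
  (forall x y, `|df x - df y| <= L * `|x - y|) ->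
  forall x y, `|f y - f x - df x * (y - x)| <= L * (y - x) ^+ 2.
Proof.
move=> H HL x y; have [c cxy ->] := mean_value x y H.
rewrite -mulrBl normrM -(real_normK (num_real (y - x))) expr2 mulrA.
rewrite ler_wpM2r//; apply: le_trans (HL _ _) _.
have L0 : 0 <= L.
  have := HL (x + 1) x; rewrite (_ : x + 1 - x = 1) ?normr1 ?mulr1; last by ring.
  exact/le_trans/normr_ge0.
rewrite ler_wpM2l//.
move: cxy; have [xy|yx] := leP x y => /andP[xc cy].
  by rewrite !ger0_norm ?subr_ge0// lerB.
by rewrite !ler0_norm ?subr_le0 ?(ltW yx)// lerN2 lerB.
Qed.

Lemma lipschitz_continuous f L :
  (forall x y, `|f x - f y| <= L * `|x - y|) -> continuous f.
Proof.
move=> HL x; apply/cvgrPdist_le => e e0; near=> y.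
apply: le_trans (HL _ _) _.
have : `|x - y| <= e / (`|L| + 1).
  by near: y; apply: cvgr_dist_le; [exact: cvg_id|rewrite divr_gt0// ltr_wpDl].
rewrite ler_pdivlMr ?ltr_wpDl//.
have := ler_norm L; have := normr_ge0 (x - y); nra.
Unshelve. all: by end_near. Qed.

End calculus.

(** * Families of functions with uniform regularity *)

Section regular_families.
Context {R : realType}.
Implicit Types (F : R -> R -> R) (G : R * R -> R) (h y z a b : R).

(** In [F h y] the variable of interest is [y]; [h] is a parameter that will be
    integrated out.  Continuity in [h] is there to make [F h y] measurable in
    [h]; bounds and Lipschitz constants are uniform in [h], so that they pass
    to the integral. *)
Definition lip_family F : Prop :=
  [/\ exists L : R, forall h y z, `|F h y - F h z| <= L * `|y - z|,
      exists M : R, forall h y, `|F h y| <= M &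
      forall y, continuous (F ^~ y)].

(** Functions of class C^{k,1} in [y], bounded together with their derivatives.
    The recursion on a derivative makes the stability of the class under
    products and compositions a plain induction on [k], without formulas for
    higher derivatives. *)
Fixpoint Ck1_family (k : nat) F : Prop :=
  lip_family F /\
  if k is k'.+1 then
    exists F', (forall h y, is_derive y 1 (F h) (F' h y)) /\ Ck1_family k' F'
  else True.

(** The derivatives of order less than [k] of a C^{k,1} function on the plane
    may be unbounded, but the flux is only evaluated at values of a bounded
    profile: bounds on squares suffice. *)
Definition locally_lip G : Prop :=
  forall M, exists B L : R, forall a b a' b',
    `|a| <= M -> `|b| <= M -> `|a'| <= M -> `|b'| <= M ->
    `|G (a, b)| <= B /\ `|G (a, b) - G (a', b')| <= L * (`|a - a'| + `|b - b'|).

Fixpoint Ck1_loc (k : nat) G : Prop :=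
  locally_lip G /\
  if k is k'.+1 then
    exists G1 G2,
      [/\ forall a b, is_derive a 1 (fun a => G (a, b)) (G1 (a, b)),
          forall a b, is_derive b 1 (fun b => G (a, b)) (G2 (a, b)),
          Ck1_loc k' G1 & Ck1_loc k' G2]
  else True.

Lemma Ck1_familyW k F : Ck1_family k F -> lip_family F.
Proof. by case: k => [|k] []. Qed.

Lemma Ck1_familyS k F : Ck1_family k.+1 F -> Ck1_family k F.
Proof.
elim: k F => [|k IH] F; first by case.
by move=> [F0 [F' [dF HF']]]; split => //; exists F'; split => //; exact: IH.
Qed.

Lemma Ck1_locW k G : Ck1_loc k G -> locally_lip G.
Proof. by case: k => [|k] []. Qed.

Lemma Ck1_locS k G : Ck1_loc k.+1 G -> Ck1_loc k G.
Proof.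
elim: k G => [|k IH] G; first by case.
move=> [G0 [G1 [G2 [d1 d2 H1 H2]]]]; split => //.
by exists G1, G2; split => //; exact: IH.
Qed.

Lemma lipschitz_locally_lip G (L : R) :
  (forall a b a' b', `|G (a, b) - G (a', b')| <= L * (`|a - a'| + `|b - b'|)) ->
  locally_lip G.
Proof.
move=> HL M; exists (`|G (0, 0)| + `|L| * (M + M)), L.
move=> a b a' b' aM bM a'M b'M; split => //.
rewrite -[G (a, b)](subrK (G (0, 0))) addrC.
apply: le_trans (ler_normD _ _) _; rewrite lerD2l.
apply: le_trans (HL _ _ _ _) _; rewrite !subr0.
apply: (@le_trans _ _ (`|L| * (`|a| + `|b|))).
  by rewrite ler_wpM2r ?addr_ge0// ler_norm.
by rewrite ler_wpM2l// lerD.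
Qed.

Lemma lip_familyD F1 F2 : lip_family F1 -> lip_family F2 ->
  lip_family (fun h y => F1 h y + F2 h y).
Proof.
move=> [[L1 HL1] [M1 HM1] c1] [[L2 HL2] [M2 HM2] c2]; split.
- exists (L1 + L2) => h y z; rewrite mulrDl.
  rewrite (_ : _ - _ = F1 h y - F1 h z + (F2 h y - F2 h z)); last by ring.
  by apply: le_trans (ler_normD _ _) _; exact: lerD.
- exists (M1 + M2) => h y; apply: le_trans (ler_normD _ _) _; exact: lerD.
- by move=> y h; exact: cvgD (c1 y h) (c2 y h).
Qed.

Lemma lip_familyM F1 F2 : lip_family F1 -> lip_family F2 ->
  lip_family (fun h y => F1 h y * F2 h y).
Proof.
move=> [[L1 HL1] [M1 HM1] c1] [[L2 HL2] [M2 HM2] c2]; split.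
- exists (M1 * L2 + M2 * L1) => h y z.
  rewrite (_ : _ - _ = F1 h y * (F2 h y - F2 h z) +
    F2 h z * (F1 h y - F1 h z)); last by ring.
  apply: le_trans (ler_normD _ _) _; rewrite mulrDl -!mulrA.
  by apply: lerD; rewrite normrM; apply: ler_pM.
- by exists (M1 * M2) => h y; rewrite normrM ler_pM.
- by move=> y h; exact: cvgM (c1 y h) (c2 y h).
Qed.

Lemma Ck1_familyD k F1 F2 : Ck1_family k F1 -> Ck1_family k F2 ->
  Ck1_family k (fun h y => F1 h y + F2 h y).
Proof.
elim: k F1 F2 => [|k IH] F1 F2.
  by move=> [? _] [? _]; split => //; exact: lip_familyD.
move=> [l1 [F1' [d1 H1]]] [l2 [F2' [d2 H2]]]; split; first exact: lip_familyD.
exists (fun h y => F1' h y + F2' h y); split; last exact: IH.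
by move=> h y; have := d1 h y; have := d2 h y => ? ?; exact: is_deriveD.
Qed.

Lemma Ck1_familyM k F1 F2 : Ck1_family k F1 -> Ck1_family k F2 ->
  Ck1_family k (fun h y => F1 h y * F2 h y).
Proof.
elim: k F1 F2 => [|k IH] F1 F2.
  by move=> [? _] [? _]; split => //; exact: lip_familyM.
move=> H1 H2; have := Ck1_familyS H1; have := Ck1_familyS H2.
move: H1 H2 => [l1 [F1' [d1 H1]]] [l2 [F2' [d2 H2]]] H2' H1'.
split; first exact: lip_familyM.
exists (fun h y => F1 h y * F2' h y + F2 h y * F1' h y); split; last first.
  by apply: Ck1_familyD; exact: IH.
by move=> h y; have := d1 h y; have := d2 h y => ? ?; exact: is_deriveM.
Qed.

Lemma Ck1_family_cst k (a : R) : Ck1_family k (fun _ _ => a).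
Proof.
have H b : lip_family (fun _ _ => b).
  split; [|by exists `|b| => ? ?|by move=> y; exact: cst_continuous].
  by exists 0 => *; rewrite subrr normr0 mul0r.
elim: k a => [|k IH] a; split => //.
exists (fun _ _ => 0); split; last exact: IH.
by move=> h y; exact: is_derive_cst.
Qed.

Lemma lip_family_comp G F1 F2 : locally_lip G ->
  lip_family F1 -> lip_family F2 -> lip_family (fun h y => G (F1 h y, F2 h y)).
Proof.
move=> HG [[L1 HL1] [M1 HM1] c1] [[L2 HL2] [M2 HM2] c2].
have [B [L HBL]] := HG (Num.max M1 M2).
have b1 h y : `|F1 h y| <= Num.max M1 M2 by rewrite le_max HM1.
have b2 h y : `|F2 h y| <= Num.max M1 M2 by rewrite le_max HM2 orbT.
have {}HBL h y h' z : `|G (F1 h y, F2 h y)| <= B /\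
  `|G (F1 h y, F2 h y) - G (F1 h' z, F2 h' z)| <=
  `|L| * (`|F1 h y - F1 h' z| + `|F2 h y - F2 h' z|).
  have [? H] := HBL _ _ _ _ (b1 h y) (b2 h y) (b1 h' z) (b2 h' z).
  split => //; apply: le_trans H _; apply: ler_wpM2r (ler_norm _).
  exact: addr_ge0.
split.
- exists (`|L| * (L1 + L2)) => h y z.
  have [_] := HBL h y h z; move/le_trans; apply; rewrite -mulrA ler_wpM2l//.
  by rewrite mulrDl lerD.
- by exists B => h y; have [] := HBL h y h y.
- move=> y h; apply/cvgrPdist_le => e e0; near=> h'.
  have [_] := HBL h y h' y; move/le_trans; apply.
  have A1 : `|F1 h y - F1 h' y| <= e / (`|L| + 1) / 2.
    by near: h'; move: (c1 y h) => /cvgrPdist_le; apply; rewrite !divr_gt0// ltr_wpDl.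
  have A2 : `|F2 h y - F2 h' y| <= e / (`|L| + 1) / 2.
    by near: h'; move: (c2 y h) => /cvgrPdist_le; apply; rewrite !divr_gt0// ltr_wpDl.
  have : `|F1 h y - F1 h' y| + `|F2 h y - F2 h' y| <= e / (`|L| + 1).
    by rewrite [leRHS]splitr lerD.
  rewrite ler_pdivlMr ?ltr_wpDl// mulrC; apply: le_trans.
  by rewrite ler_wpM2r ?addr_ge0// lerDl.
Unshelve. all: by end_near. Qed.

(** The chain rule, from partial derivatives that are locally Lipschitz.  After
    subtraction of the linearization, the mean value theorem in each variable
    leaves an error that is quadratic in the increments of [u] and [v]. *)
Lemma is_derive_pair_comp G G1 G2 (u v u' v' : R -> R) (Lu Lv M : R) y :
  (forall a b, is_derive a 1 (fun a => G (a, b)) (G1 (a, b))) ->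
  (forall a b, is_derive b 1 (fun b => G (a, b)) (G2 (a, b))) ->
  locally_lip G1 -> locally_lip G2 ->
  (forall z, `|u z| <= M) -> (forall z, `|v z| <= M) ->
  (forall z w, `|u z - u w| <= Lu * `|z - w|) ->
  (forall z w, `|v z - v w| <= Lv * `|z - w|) ->
  is_derive y 1 u (u' y) -> is_derive y 1 v (v' y) ->
  is_derive y 1 (fun y => G (u y, v y))
    (G1 (u y, v y) * u' y + G2 (u y, v y) * v' y).
Proof.
move=> d1 d2 /(_ M)[B1 [L1 H1]] /(_ M)[B2 [L2 H2]] bu bv lu lv du dv.
pose a := u y; pose b := v y.
(* the error term of the linearization of [G] at [(u y, v y)] *)
pose r z := G (u z, v z) - (G1 (a, b) * u z + G2 (a, b) * v z).
have between (p q c : R) : Num.min p q <= c <= Num.max p q ->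
    `|p| <= M -> `|q| <= M -> `|c| <= M /\ `|c - p| <= `|q - p|.
  rewrite !ler_norml; have [pq|qp] := leP p q => /andP[? ?] /andP[? ?] /andP[? ?].
    rewrite (ger0_norm (_ : 0 <= q - p)) ?subr_ge0//.
    by split; apply/andP; split; lra.
  rewrite (ler0_norm (_ : q - p <= 0)); last by rewrite subr_le0 ltW.
  by split; apply/andP; split; lra.
have dr : is_derive y 1 r 0.
  apply: (@is_derive_quadratic _ _ _ _
    (`|L1| * (Lu + Lv) * Lu + `|L2| * Lv * Lv)) => z.
  rewrite mul0r subr0 /r -/a -/b.
  have [c1 c1b e1] := mean_value a (u z) (fun t => d1 t (v z)).
  have [c2 c2b e2] := mean_value b (v z) (fun t => d2 a t).
  have -> : G (u z, v z) - (G1 (a, b) * u z + G2 (a, b) * v z) -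
     (G (a, b) - (G1 (a, b) * a + G2 (a, b) * b)) =
     (G (u z, v z) - G (a, v z) - G1 (a, b) * (u z - a)) +
     (G (a, v z) - G (a, b) - G2 (a, b) * (v z - b)) by ring.
  rewrite e1 e2 -!mulrBl.
  have [c1M c1a] := between _ _ _ c1b (bu y) (bu z).
  have [c2M c2a] := between _ _ _ c2b (bv y) (bv z).
  have [_ E1] := H1 _ _ _ _ c1M (bv z) (bu y) (bv y).
  have [_ E2] := H2 _ _ _ _ (bu y) c2M (bu y) (bv y).
  move: E2; rewrite subrr normr0 add0r => E2.
  have lu' := lu z y; have lv' := lv z y.
  apply: le_trans (ler_normD _ _) _; rewrite !normrM mulrDl.
  rewrite -(real_normK (num_real (z - y))).
  have zy0 := normr_ge0 (z - y); set s := `|z - y| in zy0 lu' lv' *.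
  apply: lerD.
  - apply: (@le_trans _ _ ((`|L1| * ((Lu + Lv) * s)) * (Lu * s))); last first.
      by rewrite le_eqVlt; apply/orP; left; apply/eqP; ring.
    apply: ler_pM => //; apply: le_trans E1 _.
    apply: (@le_trans _ _ (`|L1| * (`|c1 - u y| + `|v z - v y|))).
      by apply: ler_wpM2r (ler_norm _); exact: addr_ge0.
    apply: ler_wpM2l => //; rewrite mulrDl lerD//.
    exact: le_trans c1a _.
  - apply: (@le_trans _ _ ((`|L2| * (Lv * s)) * (Lv * s))); last first.
      by rewrite le_eqVlt; apply/orP; left; apply/eqP; ring.
    apply: ler_pM => //; apply: le_trans E2 _.
    apply: (@le_trans _ _ (`|L2| * (`|c2 - v y|))).
      by apply: ler_wpM2r (ler_norm _).
    by apply: ler_wpM2l => //; exact: le_trans c2a _.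
have H := is_deriveD dr (is_deriveD (is_deriveZ (G1 (a, b)) du)
  (is_deriveZ (G2 (a, b)) dv)).
rewrite (_ : (fun y => G (u y, v y)) =
  r + (G1 (a, b) \*: u + G2 (a, b) \*: v)); last first.
  by apply/funext => z; rewrite /r /GRing.add /GRing.scale /= subrK.
by apply: is_derive_eq H _; rewrite add0r.
Qed.

(** The derivative of the composite is [G1(F1, F2) F1' + G2(F1, F2) F2'], whose
    factors are of class C^{k-1,1} by induction. *)
Lemma Ck1_family_comp k G F1 F2 : Ck1_loc k G ->
  Ck1_family k F1 -> Ck1_family k F2 ->
  Ck1_family k (fun h y => G (F1 h y, F2 h y)).
Proof.
elim: k G F1 F2 => [|k IH] G F1 F2.
  by move=> [? _] [? _] [? _]; split => //; exact: lip_family_comp.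
move=> HG H1 H2.
have [H1' H2'] := (Ck1_familyS H1, Ck1_familyS H2).
case: HG => lG [G1 [G2 [dG1 dG2 HG1 HG2]]].
case: H1 H2 => l1 [F1' [d1 H1]] [l2 [F2' [d2 H2]]].
split; first exact: lip_family_comp.
exists (fun h y => G1 (F1 h y, F2 h y) * F1' h y + G2 (F1 h y, F2 h y) * F2' h y).
split; last by apply: Ck1_familyD; apply: Ck1_familyM => //; exact: IH.
move=> h y.
case: l1 l2 => [[L1 HL1] [M1 HM1] c1] [[L2 HL2] [M2 HM2] c2].
apply: (@is_derive_pair_comp G G1 G2 (F1 h) (F2 h) (F1' h) (F2' h) L1 L2
  (Num.max M1 M2)) => //.
- exact: Ck1_locW HG1.
- exact: Ck1_locW HG2.
- by move=> z; rewrite le_max HM1.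
- by move=> z; rewrite le_max HM2 orbT.
Qed.

End regular_families.

(** * The nonlocal flux operator preserves regularity *)

Section regularity.
Context {R : realType}.
Local Notation mu := (@lebesgue_measure R).
Implicit Types (F : R -> R -> R) (G : R * R -> R) (h y z a b : R).

Lemma integrableM_bounded d (T : measurableType d)
    (nu : {measure set T -> \bar R}) (kap f : T -> R) (M : R) :
  nu.-integrable setT (EFin \o kap) -> measurable_fun setT f ->
  (forall x, `|f x| <= M) -> nu.-integrable setT (EFin \o (fun x => kap x * f x)).
Proof.
move=> ik mf fM.
apply: (@le_integrable _ _ _ _ _ _ _ (fun x => M%:E * (EFin \o kap) x)%E) => //.
- apply/measurable_EFinP; apply: measurable_funM => //.
  by apply/measurable_EFinP; exact: measurable_int ik.
- move=> x _ /=; rewrite lee_fin !normrM mulrC ler_wpM2r//.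
  exact: le_trans (fM x) (ler_norm _).
- exact: integrableZl.
Qed.

Lemma integrable_realZl d (T : measurableType d)
    (nu : {measure set T -> \bar R}) (D : set T) (f : T -> R) (r : R) :
  measurable D -> nu.-integrable D (EFin \o f) ->
  nu.-integrable D (EFin \o (fun x => r * f x)).
Proof. by move=> mD fi; exact: (integrableZl mD r fi). Qed.

Lemma integrable_realD d (T : measurableType d)
    (nu : {measure set T -> \bar R}) (f1 f2 : T -> R) :
  nu.-integrable setT (EFin \o f1) -> nu.-integrable setT (EFin \o f2) ->
  nu.-integrable setT (EFin \o (fun x => f1 x + f2 x)).
Proof. exact: integrableD. Qed.

Lemma integrable_realB d (T : measurableType d)
    (nu : {measure set T -> \bar R}) (f1 f2 : T -> R) :
  nu.-integrable setT (EFin \o f1) -> nu.-integrable setT (EFin \o f2) ->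
  nu.-integrable setT (EFin \o (fun x => f1 x - f2 x)).
Proof. exact: integrableB. Qed.

Lemma Ck1_family_shift k (w : R -> R) (s : R) : Ck1_family k (fun _ => w) ->
  Ck1_family k (fun h y => w (y + s * h)).
Proof.
have lipw (w' : R -> R) : lip_family (fun _ => w') ->
    lip_family (fun h y => w' (y + s * h)).
  case=> [[L HL] [M HM] _]; split.
  - exists L => h y z; apply: le_trans (HL 0 _ _) _.
    by rewrite [X in _ * `|X|](_ : _ = y - z)//; ring.
  - by exists M => h y; exact: (HM 0).
  - move=> y; apply: (@lipschitz_continuous _ _ (`|L| * `|s|)) => h z.
    apply: le_trans (HL 0 _ _) _.
    rewrite [X in _ * `|X|](_ : _ = s * (h - z)); last by ring.
    by rewrite normrM mulrA ler_wpM2r// ler_wpM2r// ler_norm.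
elim: k w => [|k IH] w; first by case=> /lipw.
case=> lw [F' [dF HF']]; split; first exact: lipw.
have E : F' = fun _ => F' 0.
  apply/funext => h; apply/funext => y.
  by have [_ <-] := dF h y; have [_ <-] := dF 0 y.
exists (fun h y => F' 0 (y + s * h)); split; last by apply: IH; rewrite -E.
move=> h y; have := dF 0 (y + s * h); rewrite !is_derive_growth.
by under eq_fun do rewrite addrA.
Qed.

Lemma lip_family_integrable F y (kap : R -> R) :
  mu.-integrable setT (EFin \o kap) -> lip_family F ->
  mu.-integrable setT (EFin \o (fun h => kap h * F h y)).
Proof.
move=> ik [_ [M HM] cF].
apply: (@integrableM_bounded _ _ _ _ _ M) => //.
exact: continuous_measurable_fun.
Qed.

Lemma normr_Rintegral_le (kap f : R -> R) (C : R) :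
  mu.-integrable setT (EFin \o kap) -> measurable_fun setT f ->
  (forall h, `|f h| <= C) ->
  `|\int[mu]_h (kap h * f h)| <= C * \int[mu]_h `|kap h|.
Proof.
move=> ik mf fC.
have ikn : mu.-integrable setT (EFin \o (fun h => `|kap h|)) by exact: integrable_norm.
apply: le_trans (le_normr_Rintegral _ _) _ => //.
  exact: (@integrableM_bounded _ _ _ _ _ C).
rewrite -RintegralZl//; apply: le_Rintegral => //.
- by apply: integrable_norm; exact: (@integrableM_bounded _ _ _ _ _ C).
- exact: integrable_realZl.
- by move=> h _; rewrite normrM mulrC ler_wpM2r.
Qed.

Lemma lip_family_int F (kap : R -> R) :
  mu.-integrable setT (EFin \o kap) -> lip_family F ->
  lip_family (fun _ y => \int[mu]_h (kap h * F h y)).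
Proof.
move=> ik HF.
have iF y := lip_family_integrable y ik HF.
case: HF => [[L HL] [M HM] cF].
have ikn : mu.-integrable setT (EFin \o (fun h => `|kap h|)) by exact: integrable_norm.
split.
- exists (L * \int[mu]_h `|kap h|) => _ y z.
  rewrite -RintegralB//; under eq_Rintegral do rewrite -mulrBr.
  rewrite mulrAC; apply: normr_Rintegral_le => //.
  by apply: measurable_funB; exact: continuous_measurable_fun.
- exists (M * \int[mu]_h `|kap h|) => _ y.
  by apply: normr_Rintegral_le => //; exact: continuous_measurable_fun.
- by move=> y; exact: cst_continuous.
Qed.

(** The first-order Taylor error of [F h] is quadratic, uniformly in [h], and
    integrates to a quadratic error. *)
Lemma is_derive_int F F' (kap : R -> R) y :
  mu.-integrable setT (EFin \o kap) -> lip_family F -> lip_family F' ->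
  (forall h y, is_derive y 1 (F h) (F' h y)) ->
  is_derive y 1 (fun y => \int[mu]_h (kap h * F h y))
    (\int[mu]_h (kap h * F' h y)).
Proof.
move=> ik HF HF' dF.
have iF z := lip_family_integrable z ik HF.
have iF' z := lip_family_integrable z ik HF'.
have [[L HL] _ cF'] := HF'; have [_ _ cF] := HF.
apply: (@is_derive_quadratic _ _ _ _ (L * \int[mu]_h `|kap h|)) => z.
rewrite -RintegralB// -RintegralZr// -RintegralB//; last 2 first.
- exact: integrable_realB.
- by under eq_fun do rewrite mulrC; exact: integrable_realZl.
under eq_Rintegral do rewrite -mulrBr -mulrA -mulrBr.
rewrite mulrAC; apply: normr_Rintegral_le => //; last first.
  by move=> h; apply: lipschitz_derive_taylor => // t; exact: dF.
apply: measurable_funB; first by apply: measurable_funB; exact: continuous_measurable_fun.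
by apply: measurable_funM => //; exact: continuous_measurable_fun.
Qed.

Lemma Ck1_family_int k F (kap : R -> R) :
  mu.-integrable setT (EFin \o kap) -> Ck1_family k F ->
  Ck1_family k (fun _ y => \int[mu]_h (kap h * F h y)).
Proof.
move=> ik; elim: k F => [|k IH] F; case=> lF.
  by split => //; exact: lip_family_int.
case=> F' [dF HF']; split; first exact: lip_family_int.
exists (fun _ y => \int[mu]_h (kap h * F' h y)); split; last exact: IH.
by move=> _ y; apply: is_derive_int => //; exact: Ck1_familyW HF'.
Qed.

Lemma Ck1_loc_le (j k : nat) G : (j <= k)%N -> Ck1_loc k G -> Ck1_loc j G.
Proof.
move=> /subnK <-; elim: (k - j)%N => [//|n IH]; rewrite addSn.
by move=> /Ck1_locS.
Qed.

(** With [kap h = omega h / h], this is the nonlocal term of the equation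
    applied to a function of space. *)
Definition nonlocal_flux (kap : R -> R) (g : R -> R -> R) (w : R -> R) y : R :=
  \int[mu]_h (kap h * (g (w y) (w (y + h)) - g (w (y - h)) (w y))).

Lemma Ck1_family_nonlocal_flux (kap w : R -> R) g k :
  mu.-integrable setT (EFin \o kap) -> Ck1_loc k (fun p => g p.1 p.2) ->
  Ck1_family k (fun _ => w) -> Ck1_family k (fun _ => nonlocal_flux kap g w).
Proof.
move=> ik gk wk.
apply: (Ck1_family_int (F := fun h y => g (w y) (w (y + h)) - g (w (y - h)) (w y))) => //.
have wp : Ck1_family k (fun h y => w (y + h)).
  have := Ck1_family_shift 1 wk.
  by rewrite (_ : (fun h y => w (y + 1 * h)) = (fun h y => w (y + h)))//;
    apply/funext => h; apply/funext => y; rewrite mul1r.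
have wm : Ck1_family k (fun h y => w (y - h)).
  have := Ck1_family_shift (-1) wk.
  by rewrite (_ : (fun h y => w (y + -1 * h)) = (fun h y => w (y - h)))//;
    apply/funext => h; apply/funext => y; rewrite mulN1r.
rewrite (_ : (fun h y => _) = (fun h y => g (w y) (w (y + h)) +
  -1 * g (w (y - h)) (w y))); last first.
  by apply/funext => h; apply/funext => y; rewrite mulN1r.
apply: Ck1_familyD; first exact: (Ck1_family_comp gk wk wp).
apply: Ck1_familyM; first exact: Ck1_family_cst.
exact: (Ck1_family_comp gk wm wk).
Qed.

(** The bootstrap.  The profile equation reads [c w' = nonlocal_flux w] and the
    right-hand side is as regular as [w], up to the regularity of [g]; hence
    each pass gains one derivative, starting from a Lipschitz [w] and ending
    at C^{k+1,1}. *)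
Lemma profile_Ck1 (kap w : R -> R) g (c : R) k :
  mu.-integrable setT (EFin \o kap) ->
  Ck1_loc k (fun p => g p.1 p.2) -> lip_family (fun _ => w) ->
  (forall y, is_derive y 1 w (c * nonlocal_flux kap g w y)) ->
  Ck1_family k.+1 (fun _ => w).
Proof.
move=> ik gk lw dw.
suff H j : (j <= k.+1)%N -> Ck1_family j (fun _ => w) by exact: H.
elim: j => [//|j IH]; rewrite ltnS => jk; split => //.
exists (fun _ y => c * nonlocal_flux kap g w y); split => //.
apply: Ck1_familyM; first exact: Ck1_family_cst.
by apply: Ck1_family_nonlocal_flux => //; [exact: Ck1_loc_le gk|exact: IH (leqW jk)].
Qed.

End regularity.

(** * Differentiability classes *)

Section Ck_classes.
Context {R : realType} {V : normedModType R}.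
Implicit Types (D : set V) (f : V -> R).

(** Peeling off the innermost derivative, rather than the outermost one, allows
    inductions that replace a function by its derivatives. *)
Lemma iter_derive_rcons (vs : seq V) (v : V) f :
  iter_derive (rcons vs v) f = iter_derive vs ('D_v f).
Proof. by elim: vs => //= w vs ->. Qed.

Lemma Ck_step D k f : (forall x, D x -> {for x, continuous f}) ->
  (forall v x, D x -> derivable f x v) -> (forall v, Ck D k ('D_v f)) ->
  Ck D k.+1 f.
Proof.
move=> cf df Hf; split.
- elim/last_ind => [_ x Dx v|vs w _]; first exact: df.
  by rewrite size_rcons ltnS iter_derive_rcons; have [+ _] := Hf w; exact.
- elim/last_ind => [_ x Dx|vs w _]; first exact: cf.
  by rewrite size_rcons ltnS iter_derive_rcons; have [_] := Hf w; exact.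
Qed.

Lemma Ck1_step D k f : (forall x, D x -> {for x, continuous f}) ->
  (forall v x, D x -> derivable f x v) -> (forall v, Ck1 D k ('D_v f)) ->
  Ck1 D k.+1 f.
Proof.
move=> cf df Hf; split; first by apply: Ck_step => // v; have [] := Hf v.
elim/last_ind => [//|vs w _]; rewrite size_rcons iter_derive_rcons => -[].
by have [_] := Hf w; exact.
Qed.

Lemma Ck1_derive D k f v : Ck1 D k.+1 f -> Ck1 D k ('D_v f).
Proof.
move=> [[df cf] lf]; split; [split|] => vs; rewrite -iter_derive_rcons => Hvs.
- by apply: df; rewrite size_rcons ltnS.
- by apply: cf; rewrite size_rcons ltnS.
- by apply: lf; rewrite size_rcons Hvs.
Qed.

(** The way to recognize smooth functions without computing their derivatives:
    exhibit a class of continuous functions that is stable under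
    directional derivatives. *)
Lemma smooth_class (P : (V -> R) -> Prop) :
  (forall f, P f -> continuous f) ->
  (forall f v x, P f -> derivable f x v) ->
  (forall f v, P f -> P ('D_v f)) -> forall f, P f -> smooth f.
Proof.
move=> cP dP DP f Pf k; elim: k f Pf => [|k IH] f Pf.
  by split => [//|[]//= _ x _]; exact: cP.
apply: Ck_step => [x _|v x _|v]; [exact: cP|exact: dP|].
by apply: IH; exact: DP.
Qed.

End Ck_classes.

Section plane.
Context {R : realType}.
Implicit Types (G : R * R -> R) (a b : R).

Lemma is_derive_fst G a b l :
  is_derive ((a, b) : R * R) ((1, 0) : R * R) G l <->
  is_derive a 1 (fun a => G (a, b)) l.
Proof.
have E : (fun h : R => G (h *: ((1, 0) : R * R) + (a, b))) =
  (fun h : R => G (h *: (1 : R) + a, b)).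
  apply/funext => h; congr G.
  by transitivity (h *: (1 : R) + a, h *: (0 : R) + b); rewrite // scaler0 add0r.
split=> [/is_derive_line|H]; rewrite ?E; first by move=> H; exact/is_derive_line.
by apply/is_derive_line; rewrite E; move/is_derive_line: H.
Qed.

Lemma is_derive_snd G a b l :
  is_derive ((a, b) : R * R) ((0, 1) : R * R) G l <->
  is_derive b 1 (fun b => G (a, b)) l.
Proof.
have E : (fun h : R => G (h *: ((0, 1) : R * R) + (a, b))) =
  (fun h : R => G (a, h *: (1 : R) + b)).
  apply/funext => h; congr G.
  by transitivity (h *: (0 : R) + a, h *: (1 : R) + b); rewrite // scaler0 add0r.
split=> [/is_derive_line|H]; rewrite ?E; first by move=> H; exact/is_derive_line.
by apply/is_derive_line; rewrite E; move/is_derive_line: H.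
Qed.

(** Partial derivatives that are bounded on a square make the function
    Lipschitz there, as one moves inside the square along the axes. *)
Lemma locally_lip_of_partials G G1 G2 :
  (forall a b, is_derive a 1 (fun a => G (a, b)) (G1 (a, b))) ->
  (forall a b, is_derive b 1 (fun b => G (a, b)) (G2 (a, b))) ->
  locally_lip G1 -> locally_lip G2 -> locally_lip G.
Proof.
move=> d1 d2 l1 l2 M; have [B1 [L1 H1]] := l1 M; have [B2 [L2 H2]] := l2 M.
have between (p q c : R) : Num.min p q <= c <= Num.max p q ->
    `|p| <= M -> `|q| <= M -> `|c| <= M.
  rewrite !ler_norml; have [pq|qp] := leP p q => /andP[? ?] /andP[? ?] /andP[? ?].
    by apply/andP; split; lra.
  by apply/andP; split; lra.
have lipG a b a' b' : `|a| <= M -> `|b| <= M -> `|a'| <= M -> `|b'| <= M ->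
    `|G (a, b) - G (a', b')| <= (`|B1| + `|B2|) * (`|a - a'| + `|b - b'|).
  move=> aM bM a'M b'M.
  have [c cb e1] := mean_value a' a (fun t => d1 t b).
  have [d db e2] := mean_value b' b (fun t => d2 a' t).
  have cM := between _ _ _ cb a'M aM; have dM := between _ _ _ db b'M bM.
  have [E1 _] := H1 _ _ _ _ cM bM cM bM.
  have [E2 _] := H2 _ _ _ _ a'M dM a'M dM.
  rewrite (_ : _ - _ = G (a, b) - G (a', b) + (G (a', b) - G (a', b'))); last by ring.
  rewrite e1 e2; apply: le_trans (ler_normD _ _) _; rewrite !normrM.
  rewrite mulrDl; apply: lerD; apply: ler_pM => //.
  - exact: le_trans E1 (ler_norm _).
  - by rewrite lerDl.
  - exact: le_trans E2 (ler_norm _).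
  - by rewrite lerDr.
exists (`|G (0, 0)| + (`|B1| + `|B2|) * (M + M)), (`|B1| + `|B2|).
move=> a b a' b' aM bM a'M b'M; split; last exact: lipG.
have M0 : `|0 : R| <= M by rewrite normr0; exact: le_trans aM.
rewrite -[G (a, b)](subrK (G (0, 0))) addrC.
apply: le_trans (ler_normD _ _) _; rewrite lerD2l.
apply: le_trans (lipG _ _ _ _ aM bM M0 M0) _.
by rewrite !subr0 ler_wpM2l ?addr_ge0// lerD.
Qed.

Lemma Ck1_loc_of_Ck1 k G : Ck1 setT k G -> Ck1_loc k G.
Proof.
elim: k G => [|k IH] G.
  move=> [_ /(_ [::] erefl)[L HL]]; split => //.
  apply: (@lipschitz_locally_lip _ _ `|L|) => a b a' b'.
  apply: le_trans (HL ((a, b), (a', b')) (conj I I)) _ => /=.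
  apply: (@le_trans _ _ (`|L| * `|((a, b) : R * R) - (a', b')|)).
    by rewrite ler_wpM2r// ler_norm.
  rewrite ler_wpM2l// prod_normE /= ge_max lerDl lerDr.
  by rewrite !normr_ge0.
move=> HG; have [[dG _] _] := HG.
have H1 := IH _ (Ck1_derive ((1, 0) : R * R) HG).
have H2 := IH _ (Ck1_derive ((0, 1) : R * R) HG).
have d1 a b : is_derive a 1 (fun a => G (a, b)) ('D_((1, 0) : R * R) G (a, b)).
  by apply/is_derive_fst; apply: derivableP; exact: (dG [::] isT (a, b) I).
have d2 a b : is_derive b 1 (fun b => G (a, b)) ('D_((0, 1) : R * R) G (a, b)).
  by apply/is_derive_snd; apply: derivableP; exact: (dG [::] isT (a, b) I).
split.
  exact: locally_lip_of_partials d1 d2 (Ck1_locW H1) (Ck1_locW H2).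
by exists ('D_((1, 0) : R * R) G), ('D_((0, 1) : R * R) G).
Qed.

Lemma is_derive_affine (f : R -> R) (al be ga l : R) (p v : R * R) :
  is_derive (al * p.1 + be * p.2 + ga) 1 f l ->
  is_derive p v (fun q => f (al * q.1 + be * q.2 + ga))
    ((al * v.1 + be * v.2) * l).
Proof.
move=> df; apply/is_derive_line; set m := al * v.1 + be * v.2.
rewrite (_ : (fun h : R => _) =
  f \o (fun h => h * m + (al * p.1 + be * p.2 + ga))); last first.
  by apply/funext => h /=; congr f; rewrite /m /GRing.scale/=; ring.
have da : is_derive (0 : R) 1 (fun h : R => h * m + (al * p.1 + be * p.2 + ga)) m.
  apply/is_derive_growth; apply: cvg_near_cst; near=> h.
  have h0 : h != 0 by near: h; exact: nbhs_dnbhs_neq.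
  by field.
have df' : is_derive ((fun h : R => h * m + (al * p.1 + be * p.2 + ga)) 0) 1 f l.
  by rewrite mul0r add0r.
have := @is_derive1_comp _ f
  (fun h : R => h * m + (al * p.1 + be * p.2 + ga)) _ _ _ df' da.
by move=> H; apply: is_derive_eq H _; rewrite mulrC.
Unshelve. all: by end_near. Qed.

Lemma Ck1_travel k (w : R -> R) (c : R) (D : set (R * R)) :
  Ck1_family k (fun _ => w) -> Ck1 D k (fun p => w (p.1 - c * p.2)).
Proof.
suff H a : Ck1_family k (fun _ => w) -> Ck1 D k (fun p => a * w (p.1 - c * p.2)).
  by move=> /(H 1); rewrite (_ : (fun p => 1 * _) = (fun p => w (p.1 - c * p.2)))//;
    apply/funext => p; rewrite mul1r.
have lipw (w' : R -> R) b : lip_family (fun _ => w') ->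
    exists L, L.-lipschitz (fun p : R * R => b * w' (p.1 - c * p.2)).
  move=> [[L HL] _ _]; exists (`|b| * `|L| * (1 + `|c|)) => -[[x t] [x' t']] _ /=.
  rewrite -mulrBr normrM -!mulrA ler_wpM2l//; apply: le_trans (HL 0 _ _) _.
  apply: (@le_trans _ _ (`|L| * `|x - c * t - (x' - c * t')|)).
    by rewrite ler_wpM2r// ler_norm.
  rewrite ler_wpM2l// (_ : _ - _ = (x - x') - c * (t - t')); last by ring.
  apply: le_trans (ler_normB _ _) _; rewrite normrM mulrDl mul1r lerD//.
    by rewrite prod_normE le_max lexx.
  by rewrite ler_wpM2l// prod_normE le_max lexx orbT.
have contw (w' : R -> R) b : lip_family (fun _ => w') ->
    continuous (fun p : R * R => b * w' (p.1 - c * p.2)).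
  move=> [[L HL] _ _] p; apply: cvgM; first exact: cvg_cst.
  apply: (@continuous_comp _ _ _ (fun p : R * R => p.1 - c * p.2) w'); last first.
    by apply: (@lipschitz_continuous _ w' L) => x y; exact: (HL 0).
  apply: cvgB; first exact: cvg_fst.
  by apply: cvgM; [exact: cvg_cst|exact: cvg_snd].
elim: k w a => [|k IH] w a.
  case=> lw _; split; first by split => [//|[]//= _ x _]; exact: contw.
  case=> // _; have [L HL] := lipw _ a lw; exists L.
  by move=> x _; exact: HL.
case=> lw [F' [dF HF']].
have E : F' = fun _ => F' 0.
  apply/funext => h; apply/funext => y.
  by have [_ <-] := dF h y; have [_ <-] := dF 0 y.
have dw (v p : R * R) : is_derive p v (fun p => a * w (p.1 - c * p.2))
    (a * (v.1 - c * v.2) * F' 0 (p.1 - c * p.2)).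
  have := @is_derive_affine w 1 (- c) 0 (F' 0 (1 * p.1 + - c * p.2 + 0)) p v (dF 0 _).
  rewrite (_ : (fun q : R * R => _) = (fun q => w (q.1 - c * q.2))); last first.
    by apply/funext => q; congr w; ring.
  move=> H; have := @is_deriveZ _ _ _ _ a _ _ _ H.
  move=> {}H; apply: is_derive_eq H _; rewrite /GRing.scale/=.
  rewrite (_ : 1 * p.1 + - c * p.2 + 0 = p.1 - c * p.2); last by ring.
  ring.
apply: Ck1_step => [x _|v x _|v].
- exact: contw.
- by have [] := dw v x.
- rewrite (_ : 'D_v _ = (fun p => (a * (v.1 - c * v.2)) * F' 0 (p.1 - c * p.2))).
    by apply: IH; rewrite -E.
  by apply/funext => p; have [_] := dw v p.
Qed.

End plane.

(** * A smooth bump and its primitive *)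

Section bump.
Context {R : realType}.
Local Notation mu := (@lebesgue_measure R).
Implicit Types (p q : {poly R}) (x y : R).

(** With a polynomial factor in [1 / x], the flat functions form a class that is
    stable under differentiation, see [is_derive_flat]. *)
Definition flat p x : R := if 0 < x then p.[x^-1] * expR (- x^-1) else 0.

Lemma normr_horner_expR p : exists K : R, forall y, 0 <= y -> `|p.[y]| <= K * expR y.
Proof.
have [n [C [C0 HC]]] : exists n C, 0 <= C /\
    forall y, 0 <= y -> `|p.[y]| <= C * (1 + y) ^+ n.
  elim/poly_ind: p => [|q c [n [C [C0 IH]]]].
    by exists 0%N, 0; split => // y _; rewrite horner0 normr0 mul0r.
  exists n.+1, (C + `|c|); split => [|y y0]; first exact: addr_ge0.
  have y1 : 1 <= 1 + y by rewrite lerDl.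
  rewrite hornerMXaddC; apply: le_trans (ler_normD _ _) _.
  rewrite mulrDl; apply: lerD.
    rewrite normrM exprSr mulrA; apply: ler_pM => //; first exact: IH.
    by rewrite ger0_norm// lerDr.
  by rewrite ler_peMr// exprn_ege1.
exists (C * (n.+1)`!%:R * expR 1) => y y0.
apply: le_trans (HC _ y0) _; rewrite -!mulrA ler_wpM2l// -expRD.
have y1 : 1 <= 1 + y by rewrite lerDl.
apply: (@le_trans _ _ ((1 + y) ^+ n.+1)); first by rewrite ler_weXn2l.
have := @expR_ge1Dxn R (1 + y) n (le_trans ler01 y1).
have n0 : 0 < n.+1`!%:R :> R by rewrite ltr0n fact_gt0.
move=> H; rewrite mulrC -ler_pdivrMr//; apply: le_trans H.
by rewrite lerDr.
Qed.

(** This bound makes the derivative of a flat function vanish at 0, the one point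
    where the derivative is not computed by the usual rules. *)
Lemma flat_quadratic p : exists K : R, forall x, `|flat p x| <= K * x ^+ 2.
Proof.
(* with y = 1 / x, the claim is that p(y) y^2 exp(-y) is bounded *)
have [K HK] := normr_horner_expR (p * 'X * 'X).
have K0 : 0 <= K.
  by have := HK 0 (lexx _); rewrite expR0 mulr1; apply: le_trans.
exists K => x; rewrite /flat; case: ltP => x0; last first.
  by rewrite normr0 mulr_ge0// sqr_ge0.
have xV : 0 <= x^-1 by rewrite invr_ge0 ltW.
have := HK _ xV; rewrite !hornerMX !normrM (ger0_norm xV) => H.
rewrite (gtr0_norm (expR_gt0 _)) expRN ler_pdivrMr ?expR_gt0//.
rewrite [leRHS](_ : _ = K * expR x^-1 * x * x); last by ring.
by rewrite -2?ler_pdivrMr.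
Qed.

Lemma flat_le0 p x : x <= 0 -> flat p x = 0.
Proof. by rewrite /flat ltNge => ->. Qed.

Lemma is_derive_flat p x :
  is_derive x 1 (flat p) (flat ('X ^+ 2 * (p - p^`())) x).
Proof.
have [x0|x0|->] := ltgtP x 0.
- rewrite [X in is_derive _ _ _ X]flat_le0; last exact: ltW.
  apply: (@near_eq_is_derive _ _ _ (cst 0)).
  near=> y; rewrite flat_le0// ltW//; near: y; exact: lt_nbhsl.
- apply: (@near_eq_is_derive _ _ _ (fun y => p.[y^-1] * expR (- y^-1))).
    by near=> y; rewrite /flat ifT//; near: y; exact: lt_nbhsr.
  have dV : is_derive x 1 (fun y : R => y^-1) (- x ^- 2).
    have xn0 : id x != 0 by rewrite gt_eqF.
    have H := @is_deriveV _ id x 1 1 xn0 (is_derive_id _ _).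
    apply: is_derive_eq H _.
    by rewrite /GRing.scale /= mulr1.
  have dp : is_derive x^-1 1 (horner p) (p^`()).[x^-1].
    by apply: DeriveDef; [exact: derivable_horner|rewrite -derive1E -derivE].
  have d1 := @is_derive1_comp _ (horner p) (fun y : R => y^-1) _ _ _ dp dV.
  have d2 := @is_derive1_comp _ expR (fun y : R => - y^-1) x _ _
    (is_derive_expR _) (is_deriveN dV).
  have := is_deriveM d1 d2; move=> H; apply: is_derive_eq H _.
  rewrite /flat x0 /= /GRing.scale /= hornerM hornerXn hornerD hornerN.
  by field; rewrite gt_eqF.
- rewrite [X in is_derive _ _ _ X]flat_le0//.
  have [K HK] := flat_quadratic p.
  apply: (@is_derive_quadratic _ _ _ _ K) => y.
  by rewrite mul0r !subr0 (flat_le0 _ (lexx 0)) subr0.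
Unshelve. all: by end_near. Qed.

Definition bump x : R := flat 1 x * flat 1 (1 - x).

Lemma flat1_ge0 x : 0 <= flat 1 x.
Proof.
by rewrite /flat; case: ifP => // _; rewrite hornerC mul1r expR_ge0.
Qed.

Lemma bump_ge0 x : 0 <= bump x.
Proof. by rewrite mulr_ge0// flat1_ge0. Qed.

Lemma bump_gt0 x : 0 < x < 1 -> 0 < bump x.
Proof.
case/andP=> x0 x1; rewrite /bump /flat x0 subr_gt0 x1 !hornerC !mul1r.
by rewrite mulr_gt0// expR_gt0.
Qed.

Lemma bump_le0 x : x <= 0 -> bump x = 0.
Proof. by move=> x0; rewrite /bump flat_le0// mul0r. Qed.

Lemma bump_ge1 x : 1 <= x -> bump x = 0.
Proof. by move=> x1; rewrite /bump (@flat_le0 _ (1 - x)) ?mulr0// subr_le0. Qed.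

Lemma bump_le1 x : bump x <= 1 :> R.
Proof.
have flat1 y : flat 1 y <= 1 :> R.
  rewrite /flat; case: ifPn => // y0; rewrite hornerC mul1r expR_le1.
  by rewrite oppr_le0 invr_ge0 ltW.
by rewrite /bump -[leRHS]mulr1 ler_pM// flat1_ge0.
Qed.

Lemma is_derive_continuous (f df : R -> R) :
  (forall x, is_derive x 1 f (df x)) -> continuous f.
Proof.
move=> H x; apply: differentiable_continuous; apply/derivable1_diffP.
by have [] := H x.
Qed.

Definition dbump x : R :=
  flat 1 x * - flat ('X ^+ 2 * (1 - 1^`())) (1 - x) +
  flat 1 (1 - x) * flat ('X ^+ 2 * (1 - 1^`())) x.

Lemma is_derive_flip (f : R -> R) x l :
  is_derive (1 - x) 1 f l -> is_derive x 1 (fun y => f (1 - y)) (- l).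
Proof.
move=> df.
have d1 : is_derive x (1 : R) (fun y : R => 1 - y) (-1).
  apply/is_derive_growth; apply: cvg_near_cst; near=> h.
  have h0 : h != 0 by near: h; exact: nbhs_dnbhs_neq.
  by field.
have := @is_derive1_comp _ f (fun y : R => 1 - y) x l _ df d1.
by rewrite mulrN1.
Unshelve. all: by end_near. Qed.

Lemma is_derive_bump x : is_derive x 1 bump (dbump x).
Proof.
have d1 := is_derive_flat 1 x.
have d2 := is_derive_flip (is_derive_flat 1 (1 - x)).
exact: is_deriveM d1 d2.
Qed.

Lemma continuous_bump : continuous bump.
Proof. exact: is_derive_continuous is_derive_bump. Qed.

Lemma continuous_flat p : continuous (flat p).
Proof. exact: is_derive_continuous (is_derive_flat p). Qed.

Lemma continuous_dbump : continuous dbump.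
Proof.
have c p : continuous (fun x : R => flat p (1 - x)).
  exact: is_derive_continuous (fun x => is_derive_flip (is_derive_flat p (1 - x))).
move=> x; apply: cvgD; apply: cvgM; [exact: continuous_flat|
  by apply: cvgN; exact: c|exact: c|exact: continuous_flat].
Qed.

(** The primitive of the bump, a smooth step from 0 to [step 1].  Starting the
    integral at -1, where the bump vanishes, puts [x >= 0] in the interior of
    the interval of integration and gives the derivative there. *)
Definition step x : R := \int[mu]_(t in `[-1, x]) bump t.

Lemma step_le0 x : x <= 0 -> step x = 0.
Proof.
move=> x0; rewrite /step (@eq_Rintegral _ _ _ _ _ (cst 0)).
  by rewrite Rintegral_cst// mul0r.
move=> t; rewrite inE/= in_itv/= => /andP[_ tx].
by rewrite bump_le0// (le_trans tx).
Qed.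

Lemma is_derive_step x : is_derive x 1 step (bump x).
Proof.
have [x0|x0] := ltP x 0.
  rewrite bump_le0 ?ltW//; apply: (@near_eq_is_derive _ _ _ (cst 0)).
  near=> y; rewrite step_le0// ltW//; near: y; exact: lt_nbhsl.
have [] := @continuous_FTC1_closed R bump (-1) x (x + 1).
- by rewrite ltrDl.
- apply: continuous_compact_integrable; first exact: segment_compact.
  apply: continuous_subspaceT; exact: continuous_bump.
- by apply: lt_le_trans x0; rewrite ltrN10.
- exact: continuous_bump.
- by rewrite derive1E => d1 d2; apply: DeriveDef.
Unshelve. all: by end_near. Qed.

Lemma step_ge1 x : 1 <= x -> step x = step 1.
Proof.
move=> x1; have [c] := mean_value 1 x is_derive_step.
rewrite (min_idPl x1) (max_idPr x1) => /andP[c1 _].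
by rewrite bump_ge1// mul0r => /eqP; rewrite subr_eq0 => /eqP.
Qed.

Lemma step_ndecr x y : x <= y -> step x <= step y.
Proof.
move=> xy; have [c _] := mean_value x y is_derive_step.
by rewrite -subr_ge0 => ->; rewrite mulr_ge0// ?bump_ge0// subr_ge0.
Qed.

Lemma step1_gt0 : 0 < step 1.
Proof.
have := @MVT R step bump 0 1 ltr01 (fun x _ => is_derive_step x).
case.
  by apply: continuous_subspaceT; exact: is_derive_continuous is_derive_step.
by move=> c; rewrite in_itv/= (step_le0 (lexx 0)) !subr0 mulr1 => /bump_gt0 + ->.
Qed.

Lemma step_ge0 x : 0 <= step x.
Proof.
have [x0|x0] := leP x 0; first by rewrite step_le0.
by rewrite -(step_le0 (lexx 0)); exact/step_ndecr/ltW.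
Qed.

Lemma step_le x : step x <= step 1.
Proof.
have [x1|x1] := leP x 1; first exact: step_ndecr.
by rewrite step_ge1// ltW.
Qed.

End bump.

(** * Test functions in the frame of the wave *)

Section test_functions.
Context {R : realType}.
Implicit Types (p : {poly R}) (f : R * R -> R) (a b e x t T : R).

(** The algebra generated by flat functions and steps of affine functions of
    the plane.  It contains the test functions below and is stable under
    directional derivatives, so that its elements are smooth. *)
Inductive bump_algebra : (R * R -> R) -> Prop :=
| bump_algebra_flat p al be ga :
    bump_algebra (fun q => flat p (al * q.1 + be * q.2 + ga))
| bump_algebra_step al be ga :
    bump_algebra (fun q => step (al * q.1 + be * q.2 + ga))
| bump_algebra_cst a : bump_algebra (fun=> a)
| bump_algebraD f1 f2 : bump_algebra f1 -> bump_algebra f2 ->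
    bump_algebra (fun q => f1 q + f2 q)
| bump_algebraM f1 f2 : bump_algebra f1 -> bump_algebra f2 ->
    bump_algebra (fun q => f1 q * f2 q).

Lemma bump_algebra_bump al be ga :
  bump_algebra (fun q => bump (al * q.1 + be * q.2 + ga)).
Proof.
apply: bump_algebraM; first exact: bump_algebra_flat.
rewrite (_ : (fun q => _) =
  (fun q => flat 1 (- al * q.1 + - be * q.2 + (1 - ga)))).
  exact: bump_algebra_flat.
by apply/funext => q; congr flat; ring.
Qed.

Lemma continuous_affine_comp (g : R -> R) (al be ga : R) : continuous g ->
  continuous (fun q : R * R => g (al * q.1 + be * q.2 + ga)).
Proof.
move=> cg q.
apply: (@continuous_comp _ _ _ (fun q : R * R => al * q.1 + be * q.2 + ga) g);
  last exact: cg.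
apply: cvgD; last exact: cvg_cst.
apply: cvgD; apply: cvgM; try exact: cvg_cst.
- exact: cvg_fst.
- exact: cvg_snd.
Qed.

Lemma bump_algebra_continuous f : bump_algebra f -> continuous f.
Proof.
elim=> {f}.
- by move=> p al be ga; apply: continuous_affine_comp; exact: continuous_flat.
- move=> al be ga; apply: continuous_affine_comp.
  exact: is_derive_continuous is_derive_step.
- by move=> a q; exact: cvg_cst.
- by move=> f1 f2 _ c1 _ c2 q; exact: cvgD (c1 q) (c2 q).
- by move=> f1 f2 _ c1 _ c2 q; exact: cvgM (c1 q) (c2 q).
Qed.

Lemma bump_algebra_derive f : bump_algebra f -> forall v : R * R,
  exists2 f', bump_algebra f' & forall q, is_derive q v f (f' q).
Proof.
elim=> {f}.
- move=> p al be ga v; eexists; last first.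
    by move=> q; apply: is_derive_affine; exact: is_derive_flat.
  by apply: bump_algebraM; [exact: bump_algebra_cst|exact: bump_algebra_flat].
- move=> al be ga v; eexists; last first.
    by move=> q; apply: is_derive_affine; exact: is_derive_step.
  by apply: bump_algebraM; [exact: bump_algebra_cst|exact: bump_algebra_bump].
- move=> a v; exists (fun=> 0); first exact: bump_algebra_cst.
  by move=> q; exact: is_derive_cst.
- move=> f1 f2 _ H1 _ H2 v; have [f1' b1 d1] := H1 v; have [f2' b2 d2] := H2 v.
  exists (fun q => f1' q + f2' q); first exact: bump_algebraD.
  by move=> q; exact: is_deriveD (d1 q) (d2 q).
- move=> f1 f2 A1 H1 A2 H2 v.
  have [f1' b1 d1] := H1 v; have [f2' b2 d2] := H2 v.
  exists (fun q => f1 q * f2' q + f2 q * f1' q).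
    by apply: bump_algebraD; exact: bump_algebraM.
  by move=> q; exact: is_deriveM (d1 q) (d2 q).
Qed.

Lemma bump_algebra_smooth f : bump_algebra f -> smooth f.
Proof.
apply: smooth_class => {f} [f|f v x /bump_algebra_derive/(_ v)|
  f v /bump_algebra_derive/(_ v)].
- exact: bump_algebra_continuous.
- by case=> f' _ /(_ x)[].
- case=> f' Af' d; rewrite (_ : 'D_v f = f')//.
  by apply/funext => q; have [] := d q.
Qed.

(** [mollifier a e] has integral [step 1] and concentrates at [a], from the
    right, as [e] tends to 0. *)
Definition mollifier (a e x : R) : R := bump ((x - a) / e) / e.

(** As [e] tends to 0, [plateau a b e] tends to [step 1] times the indicator of
    the interval from [a] (excluded) to [b] (included). *)
Definition plateau (a b e x : R) : R := step ((x - a) / e) - step ((x - b) / e).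

Definition dplateau (a b e x : R) : R := mollifier a e x - mollifier b e x.

(** The window is supported between 0 and [T / 2], so that a test function built
    on it vanishes near time [T] and does not see the initial datum. *)
Definition window (T t : R) : R := bump (2 / T * t).

Lemma mollifier_ge0 a e x : 0 < e -> 0 <= mollifier a e x.
Proof. by move=> e0; rewrite divr_ge0 ?bump_ge0// ltW. Qed.

Lemma mollifier_le a e x : 0 < e -> mollifier a e x <= e^-1.
Proof. by move=> e0; rewrite ler_pdivrMr// mulVf ?gt_eqF// bump_le1. Qed.

Lemma continuous_mollifier a e : continuous (mollifier a e).
Proof.
move=> x; apply: cvgM; last exact: cvg_cst.
apply: (@continuous_comp _ _ _ (fun x => (x - a) / e) bump).
  apply: cvgM; last exact: cvg_cst.
  by apply: cvgB; [exact: cvg_id|exact: cvg_cst].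
exact: continuous_bump.
Qed.

Lemma mollifier_eq0 a e x : 0 < e -> x \notin `]a, a + e[ -> mollifier a e x = 0.
Proof.
move=> e0; rewrite in_itv/= negb_and -!leNgt /mollifier => /orP[xa|xb].
  by rewrite bump_le0 ?mul0r// pmulr_lle0 ?invr_gt0// subr_le0.
by rewrite bump_ge1 ?mul0r// ler_pdivlMr// mul1r lerBrDl.
Qed.

Lemma is_derive_scaled (g : R -> R) (k m l x : R) :
  is_derive (k * x + m) 1 g l -> is_derive x 1 (fun x => g (k * x + m)) (k * l).
Proof.
move=> dg.
have d1 : is_derive x 1 (fun x => k * x + m) k.
  apply/is_derive_growth; apply: cvg_near_cst; near=> h.
  have h0 : h != 0 by near: h; exact: nbhs_dnbhs_neq.
  by field.
have := @is_derive1_comp _ g (fun y : R => k * y + m) x l _ dg d1.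
by rewrite mulrC.
Unshelve. all: by end_near. Qed.

Lemma is_derive_scaled_step a e x :
  is_derive x 1 (fun x => step ((x - a) / e)) (mollifier a e x).
Proof.
have := @is_derive_scaled step e^-1 (- a / e) _ x (is_derive_step _).
rewrite (_ : (fun x => _) = (fun x => step ((x - a) / e))).
  rewrite (_ : e^-1 * x + - a / e = (x - a) / e); last by ring.
  by rewrite mulrC.
by apply/funext => y; congr step; ring.
Qed.

Lemma is_derive_plateau a b e x :
  is_derive x 1 (plateau a b e) (dplateau a b e x).
Proof.
exact: is_deriveB (is_derive_scaled_step a e x) (is_derive_scaled_step b e x).
Qed.

Lemma plateau_ge0 a b e x : 0 < e -> a <= b -> 0 <= plateau a b e x.
Proof.
move=> e0 ab; rewrite subr_ge0; apply: step_ndecr.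
by rewrite ler_pM2r ?invr_gt0// lerB.
Qed.

Lemma plateau_le a b e x : plateau a b e x <= step 1.
Proof.
rewrite -[leRHS]subr0; apply: lerB; [exact: step_le|exact: step_ge0].
Qed.

Lemma plateau_eq0 a b e x : 0 < e -> a <= b -> x \notin `]a, b + e[ ->
  plateau a b e x = 0.
Proof.
move=> e0 ab; rewrite in_itv/= negb_and -!leNgt /plateau => /orP[xa|xb].
  have H c : x <= c -> (x - c) / e <= 0.
    by move=> xc; rewrite pmulr_lle0 ?invr_gt0// subr_le0.
  by rewrite !step_le0 ?subrr ?H// (le_trans xa).
have H c : c + e <= x -> 1 <= (x - c) / e.
  by move=> cx; rewrite ler_pdivlMr// mul1r lerBrDl.
by rewrite !(@step_ge1 _ (_ / _)) ?subrr ?H// (le_trans _ xb)// lerD2r.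
Qed.

Lemma plateau_eq1 a b e x : 0 < e -> a + e <= x <= b -> plateau a b e x = step 1.
Proof.
move=> e0 /andP[ax xb]; rewrite /plateau step_ge1; last first.
  by rewrite ler_pdivlMr// mul1r lerBrDl.
by rewrite (@step_le0 _ ((x - b) / e)) ?subr0// pmulr_lle0 ?invr_gt0// subr_le0.
Qed.

Lemma continuous_plateau a b e : continuous (plateau a b e).
Proof. exact: is_derive_continuous (is_derive_plateau a b e). Qed.

Lemma window_ge T t : 0 < T -> T / 2 <= t -> window T t = 0.
Proof.
move=> T0 Tt; rewrite /window bump_ge1// -ler_pdivrMl ?divr_gt0//.
by rewrite mulr1 invf_div.
Qed.

Lemma window_le0 T t : 0 < T -> t <= 0 -> window T t = 0.
Proof. by move=> T0 t0; rewrite /window bump_le0// pmulr_rle0 ?divr_gt0. Qed.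

Lemma is_derive_window T t : is_derive t 1 (window T) (2 / T * dbump (2 / T * t)).
Proof.
have := @is_derive_scaled bump (2 / T) 0 _ t (is_derive_bump _).
by rewrite addr0; under eq_fun do rewrite addr0.
Qed.

Lemma is_derive_window_primitive T t : T != 0 ->
  is_derive t 1 (fun t => T / 2 * step (2 / T * t)) (window T t).
Proof.
move=> T0; have := @is_derive_scaled step (2 / T) 0 _ t (is_derive_step _).
rewrite addr0; under eq_fun do rewrite addr0.
move=> H; apply: is_derive_eq (@is_deriveZ _ _ _ _ (T / 2) _ _ _ H) _.
by rewrite /GRing.scale /= mulrA /window [X in X * _](_ : _ = 1) ?mul1r//; field.
Qed.

Lemma test_function_plateau (T c a b e : R) : 0 < T -> 0 < e -> a <= b ->
  test_function T (fun q => plateau a b e (q.1 - c * q.2) * window T q.2).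
Proof.
move=> T0 e0 ab; set phi := (fun q => _).
pose B := `|a| + `|b| + e + `|c| * T.
pose box : set (R * R) := `[- B, B] `*` `[0, T / 2].
have cbox : compact box by apply: compact_setX; exact: segment_compact.
have sbox : closure [set p | phi p != 0] `<=` box.
  have /closure_id -> : closed box.
    apply: compact_closed cbox; exact: norm_hausdorff.
  apply: closureS => -[x t] /=; rewrite mulf_eq0 negb_or => /andP[H1 H2].
  have t0 : 0 <= t.
    by rewrite leNgt; apply: contra H2 => ?; rewrite window_le0// ltW.
  have tT : t <= T / 2.
    by rewrite leNgt; apply: contra H2 => ?; rewrite window_ge// ltW.
  rewrite /box /= !in_itv/= t0 tT/=; split => //.
  have : x - c * t \in `]a, b + e[ by apply: contraNT H1 => ?; rewrite plateau_eq0.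
  rewrite in_itv/= => /andP[L1 L2].
  have : `|c * t| <= `|c| * T.
    rewrite normrM ler_wpM2l// ger0_norm//; apply: le_trans tT _.
    by rewrite ler_pdivrMr// ler_pMr// ler1n.
  rewrite ler_norml => /andP[? ?].
  have := ler_norm a; have := ler_norm (- a); have := ler_norm b; have := ler_norm (- b).
  rewrite !normrN /B => *; apply/andP; split; lra.
split.
- apply: bump_algebra_smooth; apply: bump_algebraM; last first.
    have := bump_algebra_bump 0 (2 / T) 0.
    by under eq_fun do rewrite mul0r add0r addr0.
  have H d : bump_algebra (fun q => step ((q.1 - c * q.2 - d) / e)).
    have := bump_algebra_step e^-1 (- c / e) (- d / e).
    rewrite (_ : (fun q => _) = (fun q => step ((q.1 - c * q.2 - d) / e)))//.
    by apply/funext => q; congr step; ring.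
  apply: bump_algebraD; first exact: H.
  under eq_fun do rewrite -mulN1r.
  by apply: bump_algebraM; [exact: bump_algebra_cst|exact: H].
- exact: subclosed_compact (@closed_closure _ _) cbox sbox.
- move=> q /sbox[_]; rewrite /= in_itv/= => /andP[_ /le_lt_trans]; apply.
  by rewrite ltr_pdivrMr// ltr_pMr// ltr1n.
Qed.

Lemma derive_test_function (T c a b e : R) x t :
  'D_((0, 1) : R * R) (fun q => plateau a b e (q.1 - c * q.2) * window T q.2) (x, t) =
  plateau a b e (x - c * t) * (2 / T * dbump (2 / T * t)) +
  window T t * (- c * dplateau a b e (x - c * t)).
Proof.
set phi := (fun q => _).
suff [] : is_derive ((x, t) : R * R) ((0, 1) : R * R) phi
  (plateau a b e (x - c * t) * (2 / T * dbump (2 / T * t)) +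
   window T t * (- c * dplateau a b e (x - c * t))) by [].
apply/is_derive_snd; apply: is_deriveM (is_derive_window T t).
have := @is_derive_scaled (plateau a b e) (- c) x _ t (is_derive_plateau a b e _).
rewrite (_ : - c * t + x = x - c * t); last by ring.
by under eq_fun do rewrite mulNr addrC.
Qed.

End test_functions.

(** * Translations and measurability *)

Section measure_tools.
Context {R : realType}.
Local Notation mu := (@lebesgue_measure R).
Implicit Types (a h y c T : R).

Lemma measurable_fun_shift a : measurable_fun setT (fun x : R => x + a).
Proof. by apply: measurable_funD. Qed.

Lemma lebesgue_measure_shift a (A : set R) : measurable A ->
  pushforward mu ((fun x => x + a) : _ -> measurableTypeR R) A = mu A.
Proof.
move=> mA; apply/esym/lebesgue_measure_unique => //=.
  exact: measurable_fun_shift.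
move=> mf _ [[x y]] _ <-.
rewrite /pushforward (_ : _ @^-1` _ = `]x - a, y - a]%classic); last first.
  by apply/seteqP; split => z /=; rewrite !in_itv/= ltrBlDr lerBrDr.
rewrite !lebesgue_measure_itv/= !lte_fin ltrD2r; case: ifP => // _.
by rewrite -!EFinB; congr EFin; ring.
Qed.

Lemma integral_shift a (f : R -> \bar R) : measurable_fun setT f ->
  (\int[mu]_x f (x + a)%R = \int[mu]_x f x)%E.
Proof.
have ge0 (g : R -> \bar R) : measurable_fun setT g -> (forall x, 0 <= g x)%E ->
    (\int[mu]_x g (x + a)%R = \int[mu]_x g x)%E.
  move=> mg g0.
  transitivity (\int[pushforward mu ((fun x => x + a)%R : _ -> measurableTypeR R)]_x g x)%E.
    by rewrite ge0_integral_pushforward ?preimage_setT//; exact: measurable_fun_shift.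
  apply: eq_measure_integral => //=; first exact: measurable_fun_shift.
  by move=> ms A mA _; exact: lebesgue_measure_shift.
move=> mf; rewrite integralE [RHS]integralE.
congr (_ - _)%E.
- rewrite -[RHS]ge0//; last exact: measurable_funepos.
  by apply: eq_integral => x _; rewrite /= !funeposE.
- rewrite -[RHS]ge0//; last exact: measurable_funeneg.
  by apply: eq_integral => x _; rewrite /= !funenegE.
Qed.

Lemma Rintegral_shift a (f : R -> R) : measurable_fun setT f ->
  \int[mu]_x f (x + a) = \int[mu]_x f x.
Proof.
move=> mf; rewrite /Rintegral; congr fine.
exact: (@integral_shift a (EFin \o f) (measurableT_comp _ mf)).
Qed.

Lemma integrable_shift a (f : R -> R) : mu.-integrable setT (EFin \o f) ->
  mu.-integrable setT (EFin \o (fun x => f (x + a))).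
Proof.
move=> /integrableP[mf fi]; apply/integrableP; split.
  by have := measurableT_comp mf (measurable_fun_shift a).
rewrite (@integral_shift a (fun x => `|(EFin \o f) x|%E))//.
exact: measurableT_comp.
Qed.

(** The product sigma-algebra is generated by rectangles, not by open sets.
    Since [g x y] is the infimum over rational [q] of [g x q + C |y - q|], the
    function is a countable infimum of measurable ones. *)
Lemma lipschitz2_measurable (g : R -> R -> R) (C : R) :
  (forall a1 b1 a2 b2, `|g a1 b1 - g a2 b2| <= C * (`|a1 - a2| + `|b1 - b2|)) ->
  measurable_fun setT (fun p : R * R => g p.1 p.2).
Proof.
move=> HC.
have C0 : 0 <= C.
  have := HC 1 0 0 0; rewrite !subrr subr0 normr1 normr0 addr0 mulr1.
  exact: le_trans.
have mq (q : rat) : measurable_fun setT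
    (fun p : R * R => g p.1 (ratr q) + C * `|p.2 - ratr q|).
  apply: measurable_funD; last first.
    apply: measurable_funM => //; apply: measurableT_comp => //.
    by apply: measurable_funB.
  apply: (measurableT_comp (f := fun x => g x (ratr q)) _ measurable_fst).
  apply: continuous_measurable_fun; apply: (@lipschitz_continuous _ _ C) => x y.
  by have := HC x (ratr q) y (ratr q); rewrite subrr normr0 addr0.
apply: (measurability _ (@RGenInftyO.measurableE R)) => _ [_ [r ->] <-].
rewrite setTI (_ : _ @^-1` _ = \bigcup_(q : rat)
    [set p : R * R | g p.1 (ratr q) + C * `|p.2 - ratr q| < r]).
  apply: bigcupT_measurable_rat => q; have := mq q measurableT _ (measurable_itv `]-oo, r[).
  by rewrite setTI; congr measurable; apply/seteqP; split => p /=; rewrite in_itv/=.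
apply/seteqP; split => p /=; rewrite in_itv/=.
- move=> gr.
  have C1 : 0 < 2 * C + 1 by rewrite ltr_wpDl// mulr_ge0.
  pose d := (r - g p.1 p.2) / (2 * C + 1).
  have d0 : 0 < d by rewrite divr_gt0 ?subr_gt0.
  have dE : d * (2 * C + 1) = r - g p.1 p.2 by rewrite /d divfK ?gt_eqF.
  have lt_d : p.2 < p.2 + d by rewrite ltrDl.
  have [q] := rat_in_itvoo lt_d.
  rewrite in_itv/= => /andP[q1 q2]; exists q => //=.
  have := HC p.1 (ratr q) p.1 p.2; rewrite subrr normr0 add0r (distrC p.2).
  move=> /(le_trans (ler_norm _)).
  rewrite (ger0_norm (_ : 0 <= ratr q - p.2)); last by rewrite subr_ge0 ltW.
  have : C * (ratr q - p.2) <= C * d by rewrite ler_wpM2l// lerBlDl ltW.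
  lra.
- case=> q _ /=; apply: le_lt_trans.
  have := HC p.1 p.2 p.1 (ratr q); rewrite subrr normr0 add0r.
  by move=> /(le_trans (ler_norm _)); rewrite lerBlDr addrC.
Qed.

(** Valid without integrability: positive and negative parts have measurable
    marginals by Tonelli, and [fine] is measurable on the extended reals. *)
Lemma measurable_Rintegral_param (D : set R) (f : R * R -> R) :
  measurable D -> measurable_fun setT f ->
  measurable_fun setT (fun x => \int[mu]_(y in D) f (x, y)).
Proof.
move=> mD mf.
under eq_fun do rewrite Rintegral_mkcond.
have mf' : measurable_fun setT (fun p : R * R => ((fun y => f (p.1, y)) \_ D) p.2).
  rewrite (_ : (fun p : R * R => _) = f \_ [set p | D p.2]); last first.
    apply/funext => -[x y]; rewrite !patchE /=.
    have [yD|yD] := boolP (y \in D).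
      by rewrite ifT// inE/=; move: yD; rewrite inE.
    by rewrite ifF//; apply/negbTE; rewrite notin_setE/=; move: yD; rewrite notin_setE.
  apply/(measurable_restrictT _ _).1 => //; last exact: measurable_funTS.
  by have := measurable_snd (T1 := R) (T2 := R) measurableT _ mD; rewrite setTI.
set f' := (fun p : R * R => _) in mf'.
apply: measurableT_comp (@fine_measurable R setT _) _ => //.
rewrite (_ : (fun x => _) = (fun x => \int[mu]_y (EFin \o f')^\+ (x, y) -
   \int[mu]_y (EFin \o f')^\- (x, y))%E).
  apply: emeasurable_funB.
  - have H := measurable_fun_fubini_tonelli_F (m2 := mu) (EFin \o f')^\+%E.
    apply: H => //.
    by apply: measurable_funepos; exact/measurable_EFinP.
  - have H := measurable_fun_fubini_tonelli_F (m2 := mu) (EFin \o f')^\-%E.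
    apply: H => //.
    by apply: measurable_funeneg; exact/measurable_EFinP.
apply/funext => x; rewrite integralE; congr (_ - _)%E.
- by apply: eq_integral => y _; rewrite !funeposE.
- by apply: eq_integral => y _; rewrite !funenegE.
Qed.

End measure_tools.

(** * Fubini arguments on the plane *)

Section fubini_tools.
Context {R : realType}.
Local Notation mu := (@lebesgue_measure R).
Implicit Types (a h y c T s : R).

Lemma measurable_fun_shear s : measurable_fun setT (fun p : R * R => p.1 + s * p.2).
Proof. by apply: measurable_funD => //; apply: measurable_funM. Qed.

Lemma measurable_strip T : measurable (strip T : set (R * R)).
Proof.
have := measurable_snd (T1 := R) (T2 := R) measurableT _ (measurable_itv `]0, T[).
by rewrite setTI; congr measurable; apply/seteqP; split => p /=; rewrite in_itv.
Qed.

Lemma measurable_strip_line T c (Z : set R) : measurable Z ->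
  measurable (strip T `&` [set p : R * R | Z (p.1 - c * p.2)]).
Proof.
move=> mZ; apply: measurableI; first exact: measurable_strip.
have := measurable_fun_shear (- c) measurableT mZ.
by rewrite setTI; congr measurable; apply/seteqP; split => p /=; rewrite mulNr.
Qed.

(** The horizontal section of the set at a time between 0 and [T] is a translate
    of [Z]. *)
Lemma product_measure_strip T c (Z : set R) : 0 < T -> measurable Z ->
  ((mu \x mu) (strip T `&` [set p : R * R | (Z (p.1 - c * p.2))%R]) = mu Z * T%:E)%E.
Proof.
move=> T0 mZ; set A := _ `&` _.
have mA : measurable A by exact: measurable_strip_line.
rewrite -(setIT A) -integral_indic// (fubini_tonelli2 (m1 := mu) (m2 := mu))//; last first.
  by apply/measurable_EFinP; exact: measurable_indic.
transitivity (\int[mu]_(t in `]0%R, T[) (mu Z))%E; last first.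
  have muT : mu `]0, T[%classic = T%:E.
    by rewrite lebesgue_measure_itv/= lte_fin T0 sube0.
  by rewrite integral_cst// -muT.
rewrite [RHS]integral_mkcond; apply: eq_integral => t _.
rewrite /fubini_G patchE; case: ifPn => tT.
  have {}tT : 0 < t < T by move: tT; rewrite inE/= in_itv.
  transitivity (\int[mu]_x (\1_Z (x + (- (c * t)))%R)%:E)%E.
    apply: eq_integral => x _; congr EFin; rewrite !indicE; congr (nat_of_bool _)%:R.
    by apply/idP/idP; rewrite !inE /A /strip /=; [case|split].
  rewrite (@integral_shift R (- (c * t)) (fun x => (\1_Z x)%:E)); last first.
    by apply/measurable_EFinP; exact: measurable_indic.
  by rewrite integral_indic// setIT.
apply: integral0_eq => x _; congr EFin; rewrite indicE memNset// /A /strip /= => -[tT' _].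
by move/negP : tT; apply; rewrite inE/= in_itv.
Qed.

(** Used in both directions: to bring the essential bound on the wave down to
    its profile, and to lift the modification of the profile on a null set to
    the strip. *)
Lemma strip_line_null T c (Z : set R) : 0 < T -> measurable Z ->
  (mu \x mu)%E.-negligible (strip T `&` [set p : R * R | Z (p.1 - c * p.2)]) <->
  mu Z = 0%E.
Proof.
move=> T0 mZ; have mA := measurable_strip_line T c mZ.
have E := product_measure_strip c T0 mZ.
split=> [[N [mN N0 AN]]|Z0]; last by eexists; split; [exact: mA|rewrite E Z0 mul0e|].
have : (mu \x mu)%E (strip T `&` [set p : R * R | Z (p.1 - c * p.2)]) = 0%E.
  by apply: (subset_measure0 _ mN AN N0); exact: mA.
move=> /(etrans (esym E))/eqP.
rewrite mule_eq0 => /orP[/eqP//|].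
by rewrite eqe gt_eqF.
Qed.

(** Integrating first in the first variable removes the shear. *)
Lemma shear_integrable (psi kap : R -> R) s :
  mu.-integrable setT (EFin \o kap) -> mu.-integrable setT (EFin \o psi) ->
  (mu \x mu)%E.-integrable setT (EFin \o (fun p => kap p.2 * psi (p.1 + s * p.2))).
Proof.
move=> ik ip.
have mk : measurable_fun setT kap by apply/measurable_EFinP; exact: measurable_int ik.
have mp : measurable_fun setT psi by apply/measurable_EFinP; exact: measurable_int ip.
have mf : measurable_fun setT (fun p : R * R => kap p.2 * psi (p.1 + s * p.2)).
  apply: measurable_funM; first exact: measurableT_comp.
  by apply: measurableT_comp => //; exact: measurable_fun_shear.
apply/integrable21ltyP; first exact/measurable_EFinP.
rewrite (_ : (fun h => _) = (fun h => `|kap h|%:E * \int[mu]_y `|psi y|%:E)%E); last first.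
  apply/funext => h; rewrite -(@integral_shift R (s * h) (fun y => `|psi y|%:E)%E); last first.
    by apply/measurable_EFinP; exact: measurableT_comp.
  rewrite -ge0_integralZl//.
    by apply: eq_integral => y _; rewrite /= normrM EFinM.
  apply/measurable_EFinP/measurableT_comp => //.
  by apply: (measurableT_comp mp); exact: measurable_fun_shift.
rewrite ge0_integralZr//; last by apply: integral_ge0.
- move/integrableP : ik => [_ ik]; move/integrableP : ip => [_ ip].
  by rewrite lte_mul_pinfty// ?integral_ge0// ge0_fin_numE ?integral_ge0.
- by apply/measurable_EFinP; exact: measurableT_comp.
Qed.

(** Integrability of every section, not only of almost every one, makes the
    inner real-valued integrals finite everywhere. *)
Lemma Rintegral_Fubini (f : R * R -> R) :
  (mu \x mu)%E.-integrable setT (EFin \o f) ->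
  (forall x, mu.-integrable setT (EFin \o (fun y => f (x, y)))) ->
  (forall y, mu.-integrable setT (EFin \o (fun x => f (x, y)))) ->
  mu.-integrable setT (EFin \o (fun x => \int[mu]_y f (x, y))) /\
  \int[mu]_x \int[mu]_y f (x, y) = \int[mu]_y \int[mu]_x f (x, y).
Proof.
move=> fi i1 i2.
have E1 x : (\int[mu]_y f (x, y))%:E = (\int[mu]_y (f (x, y))%:E)%E.
  by rewrite /Rintegral fineK//; exact: integrable_fin_num (i1 x).
have E2 y : (\int[mu]_x f (x, y))%:E = (\int[mu]_x (f (x, y))%:E)%E.
  by rewrite /Rintegral fineK//; exact: integrable_fin_num (i2 y).
split.
  have := integrable_fubini_F fi; congr (_.-integrable _ _); apply/funext => x.
  by rewrite /= E1.
rewrite /Rintegral; congr fine.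
under eq_integral do rewrite E1.
under [RHS]eq_integral do rewrite E2.
exact: (Fubini fi).
Qed.

Section nonlocal_by_parts.
Variables (kap psi : R -> R) (Cpsi B : R).
Hypothesis ik : mu.-integrable setT (EFin \o kap).
Hypothesis ip : mu.-integrable setT (EFin \o psi).
Hypothesis bp : forall y, `|psi y| <= Cpsi.

Let mp : measurable_fun setT psi.
Proof. by apply/measurable_EFinP; exact: measurable_int ip. Qed.

Let integrable_section (gam : R * R -> R) s y : measurable_fun setT gam ->
  (forall p, `|gam p| <= B) ->
  mu.-integrable setT (EFin \o (fun h => kap h * (psi (y + s * h) * gam (y, h)))).
Proof.
move=> mg bg; apply: (@integrableM_bounded _ _ _ _ _ _ (Cpsi * B)) => //.
  apply: measurable_funM; last exact: measurableT_comp.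
  by apply: (measurableT_comp mp); apply: measurable_funD => //; exact: measurable_funM.
by move=> h; rewrite normrM ler_pM.
Qed.

Let marginals (gam : R * R -> R) s : measurable_fun setT gam ->
  (forall p, `|gam p| <= B) ->
  mu.-integrable setT
    (EFin \o (fun y => \int[mu]_h (kap h * (psi (y + s * h) * gam (y, h))))) /\
  \int[mu]_y \int[mu]_h (kap h * (psi (y + s * h) * gam (y, h))) =
  \int[mu]_h \int[mu]_y (kap h * (psi (y + s * h) * gam (y, h))).
Proof.
move=> mg bg.
apply: (@Rintegral_Fubini (fun p => kap p.2 * (psi (p.1 + s * p.2) * gam p))).
- have := @integrableM_bounded _ _ _ _ _ _ B (shear_integrable s ik ip) mg bg.
  by under eq_fun do rewrite -mulrA.
- by move=> y; exact: integrable_section.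
- move=> h /=.
  have mgh : measurable_fun setT (fun y => gam (y, h)) by exact: measurableT_comp.
  have ik1 : mu.-integrable setT (EFin \o (fun y => kap h * psi (y + s * h))).
    exact: (integrable_realZl _ measurableT (integrable_shift _ ip)).
  have := integrableM_bounded ik1 mgh (fun y => bg (y, h)).
  by under eq_fun do rewrite -mulrA.
Qed.

(** The discrete integration by parts: the term with [psi (y + h)] is moved onto
    [gam] by Fubini and the substitution [y := y - h], allowed because [kap] is
    integrable, so that the two terms of the difference can be separated. *)
Lemma nonlocal_by_parts (gam : R * R -> R) : measurable_fun setT gam ->
  (forall p, `|gam p| <= B) ->
  mu.-integrable setT (EFin \o (fun y =>
    \int[mu]_h (kap h * ((psi (y + h) - psi y) * gam (y, h))))) /\
  \int[mu]_y \int[mu]_h (kap h * ((psi (y + h) - psi y) * gam (y, h))) =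
  - \int[mu]_y (psi y * \int[mu]_h (kap h * (gam (y, h) - gam (y - h, h)))).
Proof.
move=> mg bg.
pose gam' (p : R * R) := gam (p.1 - p.2, p.2).
have mg' : measurable_fun setT gam'.
  apply: (measurableT_comp mg); apply/measurable_fun_pairP; split => /=.
    by apply: measurable_funB.
  exact: measurable_snd.
have bg' p : `|gam' p| <= B by exact: bg.
have [i1 F1] := marginals 1 mg bg.
have [i2 F2] := marginals 0 mg bg.
have [i3 F3] := marginals 0 mg' bg'.
have s1 y := integrable_section 1 y mg bg.
have s2 y := integrable_section 0 y mg bg.
have s3 y := integrable_section 0 y mg' bg'.
have E12 y : \int[mu]_h (kap h * ((psi (y + h) - psi y) * gam (y, h))) =
    \int[mu]_h (kap h * (psi (y + 1 * h) * gam (y, h))) -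
    \int[mu]_h (kap h * (psi (y + 0 * h) * gam (y, h))).
  have <- := RintegralB measurableT (s1 y) (s2 y).
  by apply: eq_Rintegral => h _; rewrite mul1r mul0r addr0; ring.
have mgy y : measurable_fun setT (fun h => gam (y, h)) by exact: measurableT_comp.
have mgy' y : measurable_fun setT (fun h => gam' (y, h)) by exact: measurableT_comp.
have E23 y : - (psi y * \int[mu]_h (kap h * (gam (y, h) - gam (y - h, h)))) =
    \int[mu]_h (kap h * (psi (y + 0 * h) * gam' (y, h))) -
    \int[mu]_h (kap h * (psi (y + 0 * h) * gam (y, h))).
  have <- := RintegralB measurableT (s3 y) (s2 y).
  have bd h : `|gam (y, h) - gam' (y, h)| <= B + B.
    by apply: le_trans (ler_normB _ _) _; rewrite lerD.
  have iy := integrableM_bounded ik (measurable_funB (mgy y) (mgy' y)) bd.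
  rewrite -mulNr; have <- := RintegralZl (- psi y) measurableT iy.
  by apply: eq_Rintegral => h _; rewrite /gam' mul0r addr0 /=; ring.
split.
  under eq_fun do rewrite E12.
  exact: integrable_realB.
transitivity (\int[mu]_y \int[mu]_h (kap h * (psi (y + 1 * h) * gam (y, h))) -
    \int[mu]_y \int[mu]_h (kap h * (psi (y + 0 * h) * gam (y, h)))).
  have <- := RintegralB measurableT i1 i2.
  by apply: eq_Rintegral => y _; exact: E12.
transitivity (- (\int[mu]_y \int[mu]_h (kap h * (psi (y + 0 * h) * gam (y, h))) -
    \int[mu]_y \int[mu]_h (kap h * (psi (y + 0 * h) * gam' (y, h))))); last first.
  congr (- _); have <- := RintegralB measurableT i2 i3.
  by apply: eq_Rintegral => y _; rewrite -opprB -E23 opprK.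
suff E13 : \int[mu]_h \int[mu]_y (kap h * (psi (y + 1 * h) * gam (y, h))) =
    \int[mu]_h \int[mu]_y (kap h * (psi (y + 0 * h) * gam' (y, h))).
  by rewrite opprB F3 -E13 -F1.
apply: eq_Rintegral => h _.
have mf : measurable_fun setT (fun y => kap h * (psi (y + 0 * h) * gam' (y, h))).
  apply: measurable_funM; first exact: measurable_cst.
  apply: measurable_funM; last exact: measurableT_comp.
  by apply: (measurableT_comp mp); apply: measurable_funD => //; exact: measurable_cst.
have <- := Rintegral_shift h mf.
by apply: eq_Rintegral => y _; rewrite /gam' /= addrK mul0r addr0 mul1r.
Qed.

End nonlocal_by_parts.

End fubini_tools.

(** * Integrals entering the weak formulation *)

Section weak_identity.
Context {R : realType}.
Local Notation mu := (@lebesgue_measure R).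
Implicit Types (a b h x y t c T : R).

Lemma measurable_inv : measurable_fun setT (fun x : R => x^-1).
Proof.
rewrite -(setUv [set (0 : R)]); apply/measurable_funU => //.
  exact: measurableC.
split; first exact: measurable_fun_set1.
apply: open_continuous_measurable_fun; first exact/closed_openC/closed_eq.
by move=> x; rewrite inE/= => /eqP x0; apply: cvgV => //; exact: cvg_id.
Qed.

Lemma FTC2_Rintegral (F f : R -> R) a b : a < b ->
  (forall x, is_derive x 1 F (f x)) -> continuous f ->
  \int[mu]_(x in `]a, b[) f x = F b - F a.
Proof.
move=> ab dF cf.
have cF := is_derive_continuous dF.
have fi : mu.-integrable `[a, b] (EFin \o f).
  apply: continuous_compact_integrable; first exact: segment_compact.
  exact: continuous_subspaceT.
rewrite Rintegral_itv_bndo_bndc; last first.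
  by apply: integrableS fi => //; apply: subset_itv; rewrite bnd_simp.
rewrite Rintegral_itv_obnd_cbnd; last first.
  by apply: integrableS fi => //; apply: subset_itv; rewrite bnd_simp.
rewrite /Rintegral (@continuous_FTC2 R f F a b)//.
- exact: continuous_subspaceT.
- split => [x _||]; first by have [] := dF x.
  + by apply: cvg_at_right_filter; exact: cF.
  + by apply: cvg_at_left_filter; exact: cF.
- by move=> x _; rewrite derive1E; have [] := dF x.
Qed.

Lemma compactly_supported_integrable (f : R -> R) a b : continuous f ->
  (forall x, x \notin `[a, b] -> f x = 0) -> mu.-integrable setT (EFin \o f).
Proof.
move=> cf f0.
have fi : mu.-integrable `[a, b] (EFin \o f).
  apply: continuous_compact_integrable; first exact: segment_compact.
  exact: continuous_subspaceT.
have := (integrable_mkcond (mu := mu) (EFin \o f) (measurable_itv `[a, b])).1 fi.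
congr (_.-integrable _ _); apply/funext => x; rewrite patchE.
by case: ifPn => //; rewrite notin_setE/= => /negP xab; rewrite /= f0.
Qed.

Lemma ae_eq_Rintegral (D : set R) (f1 f2 : R -> R) : measurable D ->
  measurable_fun D f1 -> measurable_fun D f2 ->
  {ae mu, forall x, f1 x = f2 x} ->
  \int[mu]_(x in D) f1 x = \int[mu]_(x in D) f2 x.
Proof.
move=> mD m1 m2 H; rewrite /Rintegral; congr fine.
apply: ae_eq_integral => //; try exact/measurable_EFinP.
apply: filterS H; first exact: (ae_filter_ringOfSetsType mu).
by move=> x /= -> _.
Qed.

Lemma ae_shift (P : R -> Prop) a : {ae mu, forall x, P x} ->
  {ae mu, forall x, P (x + a)}.
Proof.
move=> [N [mN N0 PN]]; exists ((fun x => x + a) @^-1` N); split.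
- by have := measurable_fun_shift a measurableT mN; rewrite setTI.
- by have := lebesgue_measure_shift a mN; rewrite /pushforward => ->.
- by move=> x /= nP; apply: PN => /=.
Qed.

Lemma Rintegral_window T : 0 < T ->
  \int[mu]_(t in `]0, T[) window T t = T / 2 * step 1.
Proof.
move=> T0.
have cw : continuous (window T) by exact: is_derive_continuous (is_derive_window T).
rewrite (FTC2_Rintegral T0 (fun t => is_derive_window_primitive t (lt0r_neq0 T0)) cw).
rewrite mulr0 (step_le0 (lexx 0)) mulr0 subr0 (_ : 2 / T * T = 2); last first.
  by rewrite divfK// gt_eqF.
by rewrite step_ge1// ler1n.
Qed.

Lemma Rintegral_dwindow T : 0 < T ->
  \int[mu]_(t in `]0, T[) (2 / T * dbump (2 / T * t)) = 0.
Proof.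
move=> T0; rewrite (FTC2_Rintegral T0 (is_derive_window T)).
  rewrite window_ge ?window_le0 ?subrr//.
  by rewrite ler_pdivrMr// ler_pMr// ler1n.
move=> t; apply: cvgM; first exact: cvg_cst.
apply: (@continuous_comp _ _ _ (fun t => 2 / T * t) dbump).
  by apply: cvgM; [exact: cvg_cst|exact: cvg_id].
exact: continuous_dbump.
Qed.

Lemma integrable_plateau a b e : 0 < e -> a <= b ->
  mu.-integrable setT (EFin \o plateau a b e).
Proof.
move=> e0 ab; apply: (@compactly_supported_integrable _ a (b + e)).
  exact: continuous_plateau.
move=> x xab; rewrite plateau_eq0//; apply: contra xab.
by apply: subset_itv_oo_cc.
Qed.

Lemma integrable_mollifier a e : 0 < e ->
  mu.-integrable setT (EFin \o mollifier a e).
Proof.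
move=> e0; apply: (@compactly_supported_integrable _ a (a + e)).
  exact: continuous_mollifier.
move=> x xab; apply: mollifier_eq0 => //; apply: contra xab.
exact: subset_itv_oo_cc.
Qed.

Lemma integrable_dplateau a b e : 0 < e ->
  mu.-integrable setT (EFin \o dplateau a b e).
Proof. by move=> e0; apply: integrable_realB; exact: integrable_mollifier. Qed.

(** The kernel [omega h / h] is integrable by assumption, which turns the
    difference quotient of the weak formulation into a bounded operator. *)
Definition weighted_kernel delta (omega : R -> R) : R -> R :=
  (fun h => omega h / h) \_ `[0, delta].

Lemma integrable_weighted_kernel delta (omega : R -> R) :
  kernel_of_horizon delta omega ->
  (\int[mu]_(h in `[0%R, delta]) (omega h / h)%:E < +oo)%E ->
  mu.-integrable setT (EFin \o weighted_kernel delta omega).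
Proof.
move=> [io om0 _ _] fin.
have mo : measurable_fun setT omega by apply/measurable_EFinP; exact: measurable_int io.
have -> : EFin \o weighted_kernel delta omega =
    (EFin \o (fun h => omega h / h)) \_ `[0, delta].
  by rewrite /weighted_kernel restrict_EFin.
apply: (integrable_mkcond (mu := mu) _ (measurable_itv _)).1; apply/integrableP; split.
  apply/measurable_EFinP; apply: measurable_funTS; apply: measurable_funM => //.
  exact: measurable_inv.
apply: le_lt_trans fin; rewrite le_eqVlt; apply/orP; left; apply/eqP.
apply: eq_integral => h; rewrite inE/= in_itv/= => /andP[h0 _].
by rewrite ger0_norm// mulr_ge0// invr_ge0.
Qed.

End weak_identity.

(** * The weak formulation tested on plateaus *)

Section plateau_identity.
Context {R : realType}.
Local Notation mu := (@lebesgue_measure R).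
Variables (T delta c : R) (omega : R -> R) (g : R -> R -> R) (v m : R -> R) (C B M : R).
Hypothesis T0 : 0 < T.
Hypothesis ho : kernel_of_horizon delta omega.
Hypothesis ho1 : (\int[mu]_(h in `[0%R, delta]) (omega h / h)%:E < +oo)%E.
Hypothesis gC : forall a1 b1 a2 b2,
  `|g a1 b1 - g a2 b2| <= C * (`|a1 - a2| + `|b1 - b2|).
Hypothesis mv : measurable_fun setT v.
Hypothesis mm : measurable_fun setT m.
Hypothesis vm : {ae mu, forall x, v x = m x}.
Hypothesis bm : forall x, `|m x| <= M.
Hypothesis bg : forall x y, `|g (m x) (m y)| <= B.
Hypothesis weak : weak_solution T delta omega g v (traveling_wave v c).

Local Notation kap := (weighted_kernel delta omega).

Let gam (p : R * R) : R := g (m p.1) (m (p.1 + p.2)).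

Let measurable_g (f1 f2 : R * R -> R) :
  measurable_fun setT f1 -> measurable_fun setT f2 ->
  measurable_fun setT (fun p => g (f1 p) (f2 p)).
Proof.
move=> m1 m2.
apply: (@measurableT_comp _ _ _ _ _ _ (fun q : R * R => g q.1 q.2) _
  (fun p => (f1 p, f2 p))); first exact: lipschitz2_measurable gC.
exact: measurable_fun_pair.
Qed.

Let measurable_plus : measurable_fun setT (fun p : R * R => p.1 + p.2).
Proof. by apply: measurable_funD. Qed.

Let measurable_gam : measurable_fun setT gam.
Proof.
by apply: measurable_g; apply: (measurableT_comp mm) => //; exact: measurable_plus.
Qed.

Let mo : measurable_fun setT omega.
Proof. by case: ho => io _ _ _; apply/measurable_EFinP; exact: measurable_int io. Qed.

Let ik : mu.-integrable setT (EFin \o kap).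
Proof. exact: integrable_weighted_kernel. Qed.

Variables (a b e : R).
Hypotheses (e0 : 0 < e) (ab : a <= b).
Local Notation psi := (plateau a b e).
Local Notation dpsi := (dplateau a b e).

Let ip : mu.-integrable setT (EFin \o psi).
Proof. exact: integrable_plateau. Qed.
Let mpsi : measurable_fun setT psi.
Proof. by apply/measurable_EFinP; exact: measurable_int ip. Qed.
Let idp : mu.-integrable setT (EFin \o dpsi).
Proof. exact: integrable_dplateau. Qed.
Let mdpsi : measurable_fun setT dpsi.
Proof. by apply/measurable_EFinP; exact: measurable_int idp. Qed.

Let bpsi (y : R) : `|psi y| <= step 1.
Proof. by rewrite ger0_norm ?plateau_ge0// plateau_le. Qed.

Let K (y : R) : R := \int[mu]_h (kap h * ((psi (y + h) - psi y) * gam (y, h))).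

Let parts : mu.-integrable setT (EFin \o K) /\
  \int[mu]_y K y = - \int[mu]_y (psi y * nonlocal_flux kap g m y).
Proof.
have bgam p : `|gam p| <= B by exact: bg.
have [iK EK] := nonlocal_by_parts ik ip bpsi measurable_gam bgam.
split; first exact: iK.
apply: etrans EK _.
apply: congr1; apply: eq_Rintegral => y _.
congr (_ * _).
by apply: eq_Rintegral => h _; rewrite /gam /= subrK.
Qed.

(* the inner integral of the nonlocal term of the weak formulation at a time
   where the window has value q, in the frame of the wave *)
Let Kt (w : R -> R) (q y : R) : R := \int[mu]_(h in `[0, delta])
  ((psi (y + h) * q - psi y * q) / h * g (w y) (w (y + h)) * omega h).

Let measurable_section (w : R -> R) (q y : R) : measurable_fun setT w ->
  measurable_fun setT (fun h => (psi (y + h) * q - psi y * q) / h *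
    g (w y) (w (y + h)) * omega h).
Proof.
move=> mw; have ms : measurable_fun setT (fun h : R => y + h) by apply: measurable_funD.
apply: measurable_funM => //; apply: measurable_funM.
  apply: measurable_funM; last exact: measurable_inv.
  apply: measurable_funB => //; apply: measurable_funM => //.
  exact: measurableT_comp.
apply: (measurableT_comp (f := g (w y))); last exact: (measurableT_comp mw).
apply: continuous_measurable_fun; apply: (@lipschitz_continuous _ _ C) => x z.
by have := gC (w y) x (w y) z; rewrite subrr normr0 add0r.
Qed.

Let measurable_Kt (q : R) : measurable_fun setT (Kt v q).
Proof.
apply: (@measurable_Rintegral_param _ _ (fun p =>
  (psi (p.1 + p.2) * q - psi p.1 * q) / p.2 * g (v p.1) (v (p.1 + p.2)) * omega p.2)) => //.
apply: measurable_funM; last exact: measurableT_comp.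
apply: measurable_funM.
  apply: measurable_funM; last exact: (measurableT_comp measurable_inv).
  apply: measurable_funB; apply: measurable_funM => //.
    exact: measurableT_comp.
  exact: measurableT_comp.
apply: measurable_g; first exact: measurableT_comp.
exact: (measurableT_comp mv).
Qed.

Let Kt_ae (q : R) : {ae mu, forall y, Kt v q y = q * K y}.
Proof.
apply: filterS vm; first exact: (ae_filter_ringOfSetsType mu).
move=> y vmy; transitivity (Kt m q y).
  apply: ae_eq_Rintegral => //; try by apply: measurable_funTS; exact: measurable_section.
  have := ae_shift y vm; apply: filterS; first exact: (ae_filter_ringOfSetsType mu).
  by move=> h; rewrite addrC vmy => ->.
have bd h : `|(psi (y + h) - psi y) * gam (y, h)| <= (step 1 + step 1) * B.
  rewrite normrM ler_pM//; last exact: bg.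
  by apply: le_trans (ler_normB _ _) _; rewrite lerD.
have md : measurable_fun setT (fun h => (psi (y + h) - psi y) * gam (y, h)).
  apply: measurable_funM; last exact: (measurableT_comp measurable_gam).
  apply: measurable_funB => //; apply: (measurableT_comp mpsi).
  by apply: measurable_funD.
rewrite /K; have <- := RintegralZl q measurableT (integrableM_bounded ik md bd).
rewrite /Kt Rintegral_mkcond; apply: eq_Rintegral => h _.
rewrite patchE /weighted_kernel patchE /gam /=.
by case: ifP => _; [ring|rewrite mul0r mulr0].
Qed.

(** For the test function [plateau a b e (x - c t) * window T t] the three terms
    of the weak formulation factor, after the translation [y = x - c t], into
    integrals in [y] and integrals in [t]: the initial term vanishes, the
    derivative of the window has integral 0, and the positive integral of the
    window drops out.  The nonlocal term is rewritten by [nonlocal_by_parts].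
    The profile [v] is replaced by the bounded function [m], which agrees with
    it almost everywhere. *)
Lemma plateau_identity :
  c * \int[mu]_y (m y * dpsi y) = - \int[mu]_y (psi y * nonlocal_flux kap g m y).
Proof.
have [iK <-] := parts.
have iP : mu.-integrable setT (EFin \o (fun y => m y * psi y)).
  by have := integrableM_bounded ip mm bm; under eq_fun do rewrite mulrC.
have iQ : mu.-integrable setT (EFin \o (fun y => m y * dpsi y)).
  by have := integrableM_bounded idp mm bm; under eq_fun do rewrite mulrC.
set P := \int[mu]_y (m y * psi y).
set Q := \int[mu]_y (m y * dpsi y); set KK := \int[mu]_y K y.
have [_ /(_ _ (test_function_plateau c T0 e0 ab))] := weak.
set phi := (fun q : R * R => plateau a b e (q.1 - c * q.2) * window T q.2).
have E1 t : \int[mu]_x (traveling_wave v c (x, t) *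
    'D_((0, 1) : R * R) phi (x, t)) =
    P * (2 / T * dbump (2 / T * t)) + (- c * Q) * window T t.
  pose F y := v y * (psi y * (2 / T * dbump (2 / T * t)) +
    window T t * (- c * dpsi y)).
  pose F' y := (2 / T * dbump (2 / T * t)) * (m y * psi y) +
    (window T t * - c) * (m y * dpsi y).
  have mF : measurable_fun setT F.
    apply: measurable_funM => //; apply: measurable_funD.
      by apply: measurable_funM.
    by apply: measurable_funM => //; exact: measurable_funM.
  transitivity (\int[mu]_x F (x + - (c * t))).
    by apply: eq_Rintegral => x _; rewrite /phi derive_test_function.
  rewrite Rintegral_shift//.
  have iF1 := integrable_realZl (2 / T * dbump (2 / T * t)) measurableT iP.
  have iF2 := integrable_realZl (window T t * - c) measurableT iQ.
  have mF' : measurable_fun setT F'.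
    by apply/measurable_EFinP; exact: measurable_int (integrable_realD iF1 iF2).
  rewrite (ae_eq_Rintegral measurableT mF mF'); last first.
    apply: filterS vm; first exact: (ae_filter_ringOfSetsType mu).
    by move=> y; rewrite /F /F' => ->; ring.
  have -> := RintegralD measurableT iF1 iF2.
  have -> := RintegralZl (2 / T * dbump (2 / T * t)) measurableT iP.
  have -> := RintegralZl (window T t * - c) measurableT iQ.
  by rewrite -/P -/Q; ring.
have E2 : \int[mu]_x (v x * phi (x, 0)) = 0.
  rewrite (@eq_Rintegral _ _ _ _ _ (cst 0)); first by rewrite Rintegral_cst// mul0r.
  by move=> x _; rewrite /phi /= window_le0// !mulr0.
have E3 t : \int[mu]_x \int[mu]_(h in `[0, delta])
    ((tau h phi (x, t) - phi (x, t)) / h * g (traveling_wave v c (x, t))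
       (tau h (traveling_wave v c) (x, t)) * omega h) = KK * window T t.
  transitivity (\int[mu]_x Kt v (window T t) (x + - (c * t))).
    apply: eq_Rintegral => x _; apply: eq_Rintegral => h _.
    rewrite /tau /traveling_wave /phi /=.
    by rewrite (_ : x + h - c * t = x - c * t + h)//; ring.
  rewrite Rintegral_shift//.
  have iq := integrable_realZl (window T t) measurableT iK.
  rewrite (ae_eq_Rintegral measurableT (measurable_Kt _) _ (Kt_ae _)); last first.
    by apply/measurable_EFinP; exact: measurable_int iq.
  have -> := RintegralZl (window T t) measurableT iK.
  by rewrite mulrC.
under eq_Rintegral do rewrite E1.
rewrite E2 addr0; under [X in _ + X]eq_Rintegral do rewrite E3.
have iw : mu.-integrable `]0, T[ (EFin \o window T).
  have H : mu.-integrable `[0, T] (EFin \o window T).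
    apply: continuous_compact_integrable; first exact: segment_compact.
    apply: continuous_subspaceT.
    exact: is_derive_continuous (is_derive_window T).
  by apply: integrableS H => //; exact: subset_itv_oo_cc.
have idw : mu.-integrable `]0, T[ (EFin \o (fun t => 2 / T * dbump (2 / T * t))).
  have H : mu.-integrable `[0, T] (EFin \o (fun t => 2 / T * dbump (2 / T * t))).
    apply: continuous_compact_integrable; first exact: segment_compact.
    apply: continuous_subspaceT => t; apply: cvgM; first exact: cvg_cst.
    apply: (@continuous_comp _ _ _ (fun t => 2 / T * t) dbump).
      by apply: cvgM; [exact: cvg_cst|exact: cvg_id].
    exact: continuous_dbump.
  by apply: integrableS H => //; exact: subset_itv_oo_cc.
have mI : measurable (`]0, T[%classic : set (measurableTypeR R)) by [].
have -> : \int[mu]_(t in `]0, T[) (P * (2 / T * dbump (2 / T * t)) + - c * Q * window T t) =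
    - c * Q * (T / 2 * step 1).
  have i1 : mu.-integrable `]0, T[ (EFin \o (fun t => P * (2 / T * dbump (2 / T * t)))).
    exact: (integrable_realZl P mI idw).
  have i2 : mu.-integrable `]0, T[ (EFin \o (fun t => - c * Q * window T t)).
    exact: (integrable_realZl (- c * Q) mI iw).
  have -> := RintegralD mI i1 i2.
  have -> := RintegralZl P mI idw; have -> := RintegralZl (- c * Q) mI iw.
  by rewrite Rintegral_window// Rintegral_dwindow// mulr0 add0r.
have -> := RintegralZl KK mI iw.
rewrite Rintegral_window// -mulrDl => /eqP; rewrite mulf_eq0.
have TS : T / 2 * step 1 != 0 by rewrite gt_eqF// mulr_gt0 ?divr_gt0// step1_gt0.
by rewrite (negbTE TS) orbF mulNr addrC subr_eq0 => /eqP.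
Qed.

End plateau_identity.

(** * Mollification at Lebesgue points *)

Section lebesgue_points.
Context {R : realType}.
Local Notation mu := (@lebesgue_measure R).
Implicit Types (a b h x y e : R).

Lemma dominated_Rintegral (D : set (measurableTypeR R)) (f_ : nat -> R -> R)
    (f dom : R -> R) : measurable D ->
  (forall n, measurable_fun D (f_ n)) -> measurable_fun D f ->
  (forall x, D x -> f_ n x @[n --> \oo] --> f x) ->
  mu.-integrable D (EFin \o dom) -> (forall n x, D x -> `|f_ n x| <= dom x) ->
  \int[mu]_(x in D) f_ n x @[n --> \oo] --> \int[mu]_(x in D) f x.
Proof.
move=> mD mf_ mf cf idom fdom.
have H1 n : measurable_fun D (EFin \o f_ n) by exact/measurable_EFinP.
have H2 : measurable_fun D (EFin \o f) by exact/measurable_EFinP.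
have H3 : {ae mu, forall x, D x -> (EFin \o f_ n) x @[n --> \oo] --> (EFin \o f) x}.
  by apply: aeW => x Dx; apply: cvg_EFin; [exact: nearW|exact: cf].
have H4 : {ae mu, forall x n, D x -> (`|(EFin \o f_ n) x| <= (EFin \o dom) x)%E}.
  by apply: aeW => x n Dx; rewrite lee_fin; exact: fdom.
have [fi _ H] := dominated_convergence mD H1 H2 H3 idom H4.
apply: fine_cvg; rewrite fineK//; exact: integrable_fin_num fi.
Qed.

Lemma Rintegral_mollifier a e : 0 < e -> \int[mu]_x mollifier a e x = step 1.
Proof.
move=> e0.
have ae : a < a + e by rewrite ltrDl.
have := FTC2_Rintegral ae (is_derive_scaled_step a e) (@continuous_mollifier _ a e).
have E1 : (a + e - a) / e = 1 by rewrite (addrC a) addrK divff ?gt_eqF.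
rewrite E1 subrr mul0r (step_le0 (lexx 0)) subr0 => <-.
rewrite [RHS]Rintegral_mkcond; apply: eq_Rintegral => x _.
rewrite patchE; case: ifPn => // xab; apply: mollifier_eq0 => //.
by apply: contra xab => ?; rewrite inE/=.
Qed.

Variables (m : R -> R) (M : R).
Hypothesis mm : measurable_fun setT m.
Hypothesis bm : forall x, `|m x| <= M.

Lemma integrable_mollifierM a e : 0 < e ->
  mu.-integrable setT (EFin \o (fun y => m y * mollifier a e y)).
Proof.
move=> e0; have := integrableM_bounded (integrable_mollifier a e0) mm bm.
by under eq_fun do rewrite mulrC.
Qed.

(** The mollifier is at most [e^-1] and lives in a ball of measure [4 * e]
    around [a], hence the factor 4 in front of the mean deviation. *)
Lemma normr_mollifier_sub a e : 0 < e ->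
  `|\int[mu]_y (m y * mollifier a e y) - m a * step 1| <=
  4 * fine (davg m a (2 * e)).
Proof.
move=> e0; have e20 : 0 < 2 * e by rewrite mulr_gt0.
rewrite -(Rintegral_mollifier a e0).
have <- := RintegralZl (m a) measurableT (integrable_mollifier a e0).
have ima := integrable_realZl (m a) measurableT (integrable_mollifier a e0).
have imm := integrable_mollifierM a e0.
have <- := RintegralB measurableT imm ima.
have id := integrable_realB imm ima.
pose ball2 : set (measurableTypeR R) := ball a (2 * e).
have mb : measurable ball2 by exact: measurable_ball.
have bE : mu ball2 = (4 * e)%:E.
  rewrite lebesgue_measure_ball ?ltW//; congr EFin; ring.
have ib : mu.-integrable ball2 (EFin \o (fun y => `|m y - m a|)).
  apply: measurable_bounded_integrable => //.
  - by suff : (mu ball2 < +oo)%E by []; rewrite bE ltry.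
  - apply: measurable_funTS; apply: measurableT_comp => //.
    exact: measurable_funB.
  - exists (M + M); split; first exact: num_real.
  move=> K MK y _; apply: le_trans (ltW MK); rewrite normr_id.
  by apply: le_trans (ler_normB _ _) _; rewrite lerD.
have -> : 4 * fine (davg m a (2 * e)) = e^-1 * \int[mu]_(y in ball2) `|m y - m a|.
  rewrite /davg /iavg -/ball2 bE.
  have -> : (\int[mu]_(y in ball2) `|((center (m a) \o m) y)%:E|)%E =
      (\int[mu]_(y in ball2) `|m y - m a|)%:E.
    by rewrite /Rintegral fineK//; exact: integrable_fin_num ib.
  rewrite inver gt_eqF ?mulr_gt0// -EFinM /= mulrA invfM mulrA divff ?mul1r//.
have ie := integrable_realZl e^-1 mb ib.
have <- := RintegralZl e^-1 mb ib.
apply: le_trans (le_normr_Rintegral measurableT id) _.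
rewrite [leRHS]Rintegral_mkcond; apply: le_Rintegral => //.
- exact: integrable_norm id.
- have := (integrable_mkcond (mu := mu) _ mb).1 ie.
  by rewrite -restrict_EFin.
- move=> y _; rewrite patchE; case: ifPn => yb.
    rewrite -mulrBl normrM mulrC ler_wpM2r// ger0_norm ?mollifier_ge0//.
    exact: mollifier_le.
  rewrite mollifier_eq0 ?mulr0 ?subrr ?normr0//.
  apply: contra yb; rewrite in_itv/= inE => /andP[ay ya].
  rewrite /ball2 /ball/= ltr_norml; apply/andP; split; lra.
Qed.

Lemma cvg_mollifier a : lebesgue_pt m a ->
  \int[mu]_y (m y * mollifier a n.+1%:R^-1 y) @[n --> \oo] --> m a * step 1.
Proof.
move=> La.
have e0 n : 0 < n.+1%:R^-1 :> R by rewrite invr_gt0.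
have H : fine (davg m a (2 * n.+1%:R^-1)) @[n --> \oo] --> (0 : R).
  have F : fine (davg m a r) @[r --> (0 : R)^'+] --> (0 : R) by exact: fine_cvg La.
  move/cvg_at_rightP : F; apply; split => [n|]; first by rewrite mulr_gt0.
  rewrite -[X in _ --> X](mulr0 2); apply: cvgM; first exact: cvg_cst.
  exact: cvg_harmonic.
apply/cvgrPdist_le => eps eps0; move/cvgrPdist_le : H => /(_ (eps / 4)).
rewrite divr_gt0// => /(_ isT); apply: filterS => n.
rewrite sub0r normrN ler_pdivlMr// mulrC => Hn.
rewrite distrC; apply: le_trans (normr_mollifier_sub a (e0 n)) _.
by apply: le_trans Hn; rewrite ler_wpM2l// ler_norm.
Qed.

End lebesgue_points.

(** * From increments at almost all points to a continuous representative *)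

Section profile.
Context {R : realType}.
Local Notation mu := (@lebesgue_measure R).
Implicit Types (a b h x y z e c K : R).

Lemma bounded_integrable_on (A : set (measurableTypeR R)) (f : R -> R) K :
  measurable A -> (mu A < +oo)%E -> measurable_fun setT f ->
  (forall x, `|f x| <= K) -> mu.-integrable A (EFin \o f).
Proof.
move=> mA fA mf fK; apply: measurable_bounded_integrable => //.
  exact: measurable_funTS.
exists K; split; first exact: num_real.
by move=> K' KK' x _; exact: le_trans (fK x) (ltW KK').
Qed.

Lemma itv_measure_lty (i j : bool) x y :
  (mu [set` Interval (BSide i x) (BSide j y)] < +oo)%E.
Proof. by rewrite lebesgue_measure_itv/=; case: ifP => // _; rewrite -EFinB ltry. Qed.

Lemma bounded_integrable_itv (f : R -> R) K x y : measurable_fun setT f ->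
  (forall x, `|f x| <= K) -> mu.-integrable `]x, y] (EFin \o f).
Proof.
by move=> mf fK; apply: bounded_integrable_on fK => //; exact: itv_measure_lty.
Qed.

Lemma fine_measure_itv_oc x y : x <= y -> fine (mu `]x, y]%classic) = y - x.
Proof.
move=> xy; rewrite lebesgue_measure_itv/= lte_fin; case: ltP => // yx.
by rewrite (@le_anti _ _ x y) ?subrr// xy.
Qed.

Lemma normr_Rintegral_itv (f : R -> R) K x y : x <= y ->
  mu.-integrable `]x, y] (EFin \o f) ->
  (forall t, x < t <= y -> `|f t| <= K) ->
  `|\int[mu]_(t in `]x, y]) f t| <= K * (y - x).
Proof.
move=> xy fi fK.
have mI : measurable (`]x, y]%classic : set (measurableTypeR R)) by [].
apply: le_trans (le_normr_Rintegral mI fi) _.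
rewrite -(fine_measure_itv_oc xy); have <- := Rintegral_cst mu mI K.
apply: le_Rintegral => //; first exact: integrable_norm fi.
  apply: (@bounded_integrable_on _ (fun=> K) `|K|) => //.
  exact: itv_measure_lty.
Qed.

Lemma ae_dense (P : R -> Prop) : {ae mu, forall x, P x} ->
  forall x e, 0 < e -> exists2 y, P y & `|x - y| < e.
Proof.
move=> [N [mN N0 PN]] x e e0; apply: contrapT => H.
have sub : ball x e `<=` N.
  by move=> y xy; apply: PN => /= Py; apply: H; exists y.
have : mu (ball x e) = 0%E.
  by apply: (subset_measure0 _ mN sub N0); exact: measurable_ball.
rewrite lebesgue_measure_ball ?ltW// => -[] /eqP.
by rewrite mulrn_eq0/= gt_eqF.
Qed.

Lemma cvg_plateau (G : R -> R) K a b : a < b -> measurable_fun setT G ->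
  (forall x, `|G x| <= K) ->
  \int[mu]_y (plateau a b n.+1%:R^-1 y * G y) @[n --> \oo] -->
  step 1 * \int[mu]_(y in `]a, b]) G y.
Proof.
move=> ab mG GK.
have e0 n : 0 < n.+1%:R^-1 :> R by rewrite invr_gt0.
have mI : measurable (`]a, b]%classic : set (measurableTypeR R)) by [].
have K0 : 0 <= K by exact: le_trans (GK 0).
have <- := RintegralZl (step 1) mI (bounded_integrable_itv a b mG GK).
rewrite Rintegral_mkcond.
apply: (@dominated_Rintegral _ setT _ _ ((fun=> step 1 * K) \_ `[a, b + 1])) => //.
- move=> n; apply: measurable_funM => //; apply: continuous_measurable_fun.
  exact: continuous_plateau.
- apply/(measurable_restrictT _ _).1 => //.
  by apply: measurable_funTS; exact: measurable_funM.
- move=> y _; rewrite patchE; case: ifPn => [|yab].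
    rewrite inE/= in_itv/= => /andP[ay yb]; apply: cvg_near_cst.
    near=> n; rewrite plateau_eq1// yb andbT -lerBrDl ltW//.
    near: n; have : 0 < y - a by rewrite subr_gt0.
    by move=> /(cvgr_lt 0 (@cvg_harmonic R)).
  have [ya|ay] := leP y a.
    apply: cvg_near_cst; apply: nearW => n.
    by rewrite plateau_eq0 ?mul0r ?ltW// in_itv/= ltNge ya.
  have yb : b < y.
    by rewrite ltNge; apply: contra yab => yb; rewrite inE/= in_itv/= ay yb.
  apply: cvg_near_cst; near=> n.
  rewrite plateau_eq0 ?mul0r ?ltW// in_itv/= negb_and -!leNgt; apply/orP; right.
  rewrite -lerBrDl ltW//; near: n; have : 0 < y - b by rewrite subr_gt0.
  by move=> /(cvgr_lt 0 (@cvg_harmonic R)).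
- have H : mu.-integrable `[a, b + 1] (EFin \o (fun=> step 1 * K)).
    apply: (@bounded_integrable_on _ _ `|step 1 * K|) => //.
    exact: itv_measure_lty.
  by have := (integrable_mkcond (mu := mu) _ (measurable_itv _)).1 H;
    rewrite -restrict_EFin.
- move=> n y _; rewrite patchE; case: ifPn => [_|yab].
    rewrite normrM ler_pM// ger0_norm ?plateau_le// plateau_ge0// ltW//.
  rewrite (plateau_eq0 (e0 n) (ltW ab)) ?mul0r ?normr0//; apply: contra yab.
  rewrite in_itv/= inE/= in_itv/= => /andP[/ltW-> /ltW yb]/=.
  by apply: le_trans yb _; rewrite lerD2l invf_le1// ler1n.
Unshelve. all: by end_near. Qed.

Lemma Rintegral_chasles (G : R -> R) K x y z : measurable_fun setT G ->
  (forall x, `|G x| <= K) -> x <= y -> y <= z ->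
  \int[mu]_(t in `]x, z]) G t =
  \int[mu]_(t in `]x, y]) G t + \int[mu]_(t in `]y, z]) G t.
Proof.
move=> mG GK xy yz.
have := Rintegral_itvB (bounded_integrable_itv x z mG GK)
  (_ : (BRight x <= BRight y)%O) (_ : (BRight y <= BRight z)%O).
by rewrite !bnd_simp => /(_ xy yz) <-; rewrite addrC subrK.
Qed.

(** Almost all points are good points, in particular one of them can serve as
    the base point of a primitive of [G]; the primitive is defined at every
    point and agrees with [m] at the good ones. *)
Lemma profile_of_jumps (m G : R -> R) K c (P : R -> Prop) : c != 0 ->
  measurable_fun setT G -> (forall x, `|G x| <= K) ->
  {ae mu, forall x, P x} ->
  (forall a b, P a -> P b -> a < b ->
    c * (m b - m a) = \int[mu]_(t in `]a, b]) G t) ->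
  exists w : R -> R, (forall x, P x -> w x = m x) /\
    forall x y, x <= y -> w y - w x = c^-1 * \int[mu]_(t in `]x, y]) G t.
Proof.
move=> c0 mG GK aeP H.
have [a0 Pa0 _] := ae_dense aeP 0 ltr01.
pose I x y := \int[mu]_(t in `]x, y]) G t.
have I0 x y : y <= x -> I x y = 0.
  by move=> yx; rewrite /I set_itv_ge ?Rintegral_set0// bnd_simp -leNgt.
have IC x y z : x <= y -> y <= z -> I x z = I x y + I y z.
  by move=> xy yz; exact: (Rintegral_chasles mG GK xy yz).
have {}H x y : P x -> P y -> x < y -> c * (m y - m x) = I x y := H x y.
(* one of the two integrals is over an empty interval *)
exists (fun x => m a0 + c^-1 * (I a0 x - I x a0)); split.
- move=> x Px; apply: (mulfI c0); rewrite mulrDr mulVKf//.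
  have [xa|xa|->] := ltgtP x a0.
  + rewrite (I0 a0 x) ?ltW// sub0r -(H _ _ Px Pa0 xa); ring.
  + rewrite (I0 x a0) ?ltW// subr0 -(H _ _ Pa0 Px xa); ring.
  + by rewrite subrr addr0.
- move=> x y xy; rewrite opprD addrACA subrr add0r -mulrBr; congr (_ * _).
  rewrite -/(I x y).
  have [xa|ax] := leP x a0.
    have [ya|ay] := leP y a0.
      rewrite (I0 a0 x xa) (I0 a0 y ya) (IC _ _ _ xy ya); ring.
    rewrite (I0 a0 x xa) (I0 y a0 (ltW ay)) (IC _ _ _ xa (ltW ay)); ring.
  have ay : a0 <= y by rewrite ltW// (lt_le_trans ax).
  rewrite (I0 x a0 (ltW ax)) (I0 y a0 ay) (IC _ _ _ (ltW ax) xy); ring.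
Qed.

Lemma ae_reflect (P : R -> Prop) a : {ae mu, forall x, P x} ->
  {ae mu, forall x, P (a - x)}.
Proof.
move=> /(ae_shift a)[N [mN N0 PN]].
exists ((-%R : R -> R) @^-1` N); split.
- by have := oppr_measurable measurableT mN; rewrite setTI.
- by have := lebesgue_measureN mN; rewrite /pushforward => ->.
- by move=> x /= nP; apply: PN => /=; rewrite addrC.
Qed.

(** At a point [y] where [w] and [m] agree, the integrands agree for almost
    every [h], because translations and reflections preserve null sets. *)
Lemma ae_eq_nonlocal_flux (kap : R -> R) (g : R -> R -> R) (C : R) (m w : R -> R) :
  (forall a1 b1 a2 b2, `|g a1 b1 - g a2 b2| <= C * (`|a1 - a2| + `|b1 - b2|)) ->
  measurable_fun setT kap -> measurable_fun setT m -> measurable_fun setT w ->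
  {ae mu, forall x, w x = m x} ->
  {ae mu, forall y, nonlocal_flux kap g w y = nonlocal_flux kap g m y}.
Proof.
move=> gC mk mm mw wm.
have mg (u : R -> R) y : measurable_fun setT u ->
    measurable_fun setT (fun h => kap h * (g (u y) (u (y + h)) - g (u (y - h)) (u y))).
  move=> mfu; apply: measurable_funM => //; apply: measurable_funB.
    apply: (measurableT_comp (f := g (u y))).
      apply: continuous_measurable_fun; apply: (@lipschitz_continuous _ _ C) => x z.
      by have := gC (u y) x (u y) z; rewrite subrr normr0 add0r.
    by apply: (measurableT_comp mfu); exact: measurable_funD.
  apply: (measurableT_comp (f := g ^~ (u y))).
    apply: continuous_measurable_fun; apply: (@lipschitz_continuous _ _ C) => x z.
    by have := gC x (u y) z (u y); rewrite subrr normr0 addr0.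
  by apply: (measurableT_comp mfu); exact: measurable_funB.
apply: filterS (wm); first exact: (ae_filter_ringOfSetsType mu).
move=> y wmy; apply: ae_eq_Rintegral => //; [exact: mg|exact: mg|].
have H1 := ae_shift y wm; have H2 := ae_reflect y wm.
apply: filterS2 H1 H2; first exact: (ae_filter_ringOfSetsType mu).
by move=> h; rewrite (addrC h y) wmy => -> ->.
Qed.

End profile.

(** * The profile is Lipschitz and solves the profile equation *)

Section lipschitz_profile.
Context {R : realType}.
Local Notation mu := (@lebesgue_measure R).
Implicit Types (x y c T M K : R).

Lemma measurable_profile T c (v : R -> R) : 0 < T ->
  measurable_fun (strip T) (traveling_wave v c) -> measurable_fun setT v.
Proof.
move=> T0 mtv.
(* j parametrizes the section of the strip at time T / 2 *)
pose j x : R * R := (x + c * (T / 2), T / 2).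
have mj : measurable_fun setT j.
  by apply: measurable_fun_pair => //; exact: measurable_funD.
rewrite (_ : v = traveling_wave v c \o j); last first.
  by apply/funext => x; rewrite /traveling_wave /j /= addrK.
apply: (measurable_comp (measurable_strip T) _ mtv mj).
move=> _ [x _ <-]; rewrite /strip /j /= divr_gt0//=.
by rewrite ltr_pdivrMr// ltr_pMr// ltr1n.
Qed.

Lemma ae_bounded_profile T c (v : R -> R) M : 0 < T -> measurable_fun setT v ->
  {ae (mu \x mu)%E, forall p, strip T p -> `|traveling_wave v c p| <= M} ->
  {ae mu, forall x, `|v x| <= M}.
Proof.
move=> T0 mv H; pose Z := [set x | M < `|v x|].
have mZ : measurable Z.
  have mn : measurable_fun setT (fun x => `|v x|) by exact: measurableT_comp.
  have := mn measurableT _ (measurable_itv `]M, +oo[).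
  by rewrite setTI; congr measurable; apply/seteqP; split => x /=; rewrite in_itv/= andbT.
have Z0 : mu Z = 0%E.
  apply/(strip_line_null c T0 mZ); case: H => N [mN N0 HN]; exists N; split => //.
  move=> p [sp /= Zp]; apply: HN => /= Hp; move: (Hp sp).
  by rewrite /traveling_wave leNgt Zp.
exists Z; split => // x /= /negP; rewrite -ltNge.
by [].
Qed.

Lemma lipschitz_of_increments (w G : R -> R) K k :
  measurable_fun setT G -> (forall x, `|G x| <= K) ->
  (forall x y, x <= y -> w y - w x = k * \int[mu]_(t in `]x, y]) G t) ->
  forall x y, `|w x - w y| <= `|k| * K * `|x - y|.
Proof.
move=> mG GK Hw.
have H x y : x <= y -> `|w y - w x| <= `|k| * K * (y - x).
  move=> xy; rewrite Hw// normrM -mulrA ler_wpM2l//.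
  by apply: normr_Rintegral_itv => //; exact: bounded_integrable_itv GK.
move=> x y; have [xy|yx] := leP x y.
  by rewrite distrC (distrC x) (ger0_norm (_ : 0 <= y - x)) ?subr_ge0// H.
rewrite (ger0_norm (_ : 0 <= x - y)); last by rewrite subr_ge0 ltW.
exact: H (ltW yx).
Qed.

(** On an interval between [x] and [y] the integrand differs from [G x] by at
    most [L] times the length, which makes the error quadratic. *)
Lemma is_derive_of_increments (w G : R -> R) K L k :
  (forall x, `|G x| <= K) -> (forall x y, `|G x - G y| <= L * `|x - y|) ->
  (forall x y, x <= y -> w y - w x = k * \int[mu]_(t in `]x, y]) G t) ->
  forall x, is_derive x 1 w (k * G x).
Proof.
move=> GK GL Hw.
have mG : measurable_fun setT G.
  exact: continuous_measurable_fun (lipschitz_continuous GL).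
have L0 : 0 <= L.
  by have := GL 1 0; rewrite subr0 normr1 mulr1; exact: le_trans.
have H z x y : x <= y -> x <= z <= y ->
    `|w y - w x - k * G z * (y - x)| <= `|k| * L * (y - x) ^+ 2.
  move=> xy /andP[xz zy]; rewrite Hw// -mulrA -mulrBr normrM -mulrA ler_wpM2l//.
  have mI : measurable (`]x, y]%classic : set (measurableTypeR R)) by [].
  have iG := bounded_integrable_itv x y mG GK.
  have ic : mu.-integrable `]x, y] (EFin \o (fun=> G z)).
    by apply: (@bounded_integrable_itv _ (fun=> G z) `|G z|).
  rewrite -{1}(fine_measure_itv_oc xy); have <- := Rintegral_cst mu mI (G z).
  have <- := RintegralB mI iG ic.
  have iB : mu.-integrable `]x, y] (EFin \o (fun t => G t - G z)).
    apply: (@bounded_integrable_itv _ _ (K + K)).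
      by apply: measurable_funB.
    by move=> t; apply: le_trans (ler_normB _ _) _; rewrite lerD.
  rewrite expr2 mulrA; apply: normr_Rintegral_itv => // t /andP[xt ty].
  apply: le_trans (GL _ _) _; rewrite ler_wpM2l// ler_norml.
  by apply/andP; split; lra.
move=> x; apply: (@is_derive_quadratic _ _ _ _ (`|k| * L)) => y.
have [xy|yx] := leP x y; first by apply: H => //; rewrite lexx.
rewrite -normrN [X in `|X|](_ : _ = w x - w y - k * G x * (x - y)); last by ring.
by rewrite -sqrrN opprB; apply: H; rewrite ?lexx ?andbT; exact: ltW.
Qed.

(** At Lebesgue points [a < b] of the profile, the identity of
    [plateau_identity] passes to the limit and gives
    [c (m b - m a) = int_a^b G], with [G] the nonlocal flux of the profile.
    As [G] is bounded and [c <> 0], the profile has a Lipschitz representative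
    [w].  Then [G] agrees almost everywhere with the nonlocal flux of [w],
    which is continuous, and [w] is differentiable at every point. *)
Lemma lipschitz_traveling_profile T delta (omega : R -> R) (g : R -> R -> R)
    (v : R -> R) c : 0 < T -> c != 0 ->
  kernel_of_horizon delta omega ->
  (\int[mu]_(h in `[0%R, delta]) (omega h / h)%:E < +oo)%E ->
  lipschitz_flux g ->
  weak_solution T delta omega g v (traveling_wave v c) ->
  measurable_fun setT v /\ exists w : R -> R,
  [/\ lip_family (fun _ => w),
      {ae mu, forall x, w x = v x} &
      forall y, is_derive y 1 w
        (c^-1 * nonlocal_flux (weighted_kernel delta omega) g w y)].
Proof.
move=> T0 c0 ho ho1 [C gC] weak.
have [[mtv [M0 bM0]] _] := weak.
have mv := measurable_profile T0 mtv; split => //.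
pose M : R := `|M0|.
have vM : {ae mu, forall x, `|v x| <= M}.
  apply: filterS (ae_bounded_profile T0 mv bM0).
    exact: (ae_filter_ringOfSetsType mu).
  by move=> x /le_trans; apply; exact: ler_norm.
have M_ge0 : 0 <= M by exact: normr_ge0.
pose m x : R := Num.max (- M) (Num.min (v x) M).
have mm : measurable_fun setT m.
  by apply: measurable_maxr => //; exact: measurable_minr.
have bm x : `|m x| <= M.
  rewrite ler_norml /m le_max lexx/= ge_max ge_min lexx orbT andbT.
  by rewrite lerNl (le_trans _ M_ge0)// oppr_le0.
have vm : {ae mu, forall x, v x = m x}.
  apply: filterS vM; first exact: (ae_filter_ringOfSetsType mu).
  move=> x; rewrite ler_norml /m => /andP[Mv vM].
  by rewrite (min_idPl vM) (max_idPr Mv).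
have [B bg] : exists B : R, forall x y, `|g (m x) (m y)| <= B.
  have [B [L H]] := lipschitz_locally_lip (G := fun p => g p.1 p.2)
    (fun a b a' b' => gC a b a' b') M.
  by exists B => x y; have [] := H _ _ _ _ (bm x) (bm y) (bm x) (bm y).
pose kap := weighted_kernel delta omega.
have ik : mu.-integrable setT (EFin \o kap) by exact: integrable_weighted_kernel.
have mk : measurable_fun setT kap by apply/measurable_EFinP; exact: measurable_int ik.
pose G := nonlocal_flux kap g m.
have mG : measurable_fun setT G.
  have mgg (f1 f2 : R * R -> R) : measurable_fun setT f1 -> measurable_fun setT f2 ->
      measurable_fun setT (fun p => g (f1 p) (f2 p)).
    move=> m1 m2.
    apply: (@measurableT_comp _ _ _ _ _ _ (fun q : R * R => g q.1 q.2) _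
      (fun p => (f1 p, f2 p))); first exact: lipschitz2_measurable gC.
    exact: measurable_fun_pair.
  apply: (@measurable_Rintegral_param _ setT (fun p => kap p.2 *
    (g (m p.1) (m (p.1 + p.2)) - g (m (p.1 - p.2)) (m p.1)))) => //.
  apply: measurable_funM; first exact: measurableT_comp.
  apply: measurable_funB; apply: mgg; try exact: measurableT_comp.
    by apply: (measurableT_comp mm); exact: measurable_funD.
  by apply: (measurableT_comp mm); exact: measurable_funB.
pose K : R := (B + B) * \int[mu]_h `|kap h|.
have gl a : continuous (g a).
  apply: (@lipschitz_continuous _ _ C) => x z.
  by have := gC a x a z; rewrite subrr normr0 add0r.
have gr b : continuous (g ^~ b).
  apply: (@lipschitz_continuous _ _ C) => x z.
  by have := gC x b z b; rewrite subrr normr0 addr0.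
have GK y : `|G y| <= K.
  apply: normr_Rintegral_le => //; last first.
    by move=> h; apply: le_trans (ler_normB _ _) _; rewrite lerD.
  apply: measurable_funB.
    apply: (measurableT_comp (f := g (m y))); first exact: continuous_measurable_fun.
    by apply: (measurableT_comp mm); exact: measurable_funD.
  apply: (measurableT_comp (f := g ^~ (m y))); first exact: continuous_measurable_fun.
  by apply: (measurableT_comp mm); exact: measurable_funB.
have lm : {ae mu, forall x, lebesgue_pt m x}.
  apply: lebesgue_differentiation; split => //; first exact: openT.
  move=> A _ cA; have iA : mu.-integrable A (EFin \o m).
    apply: (bounded_integrable_on _ _ mm bm); first exact: compact_measurable.
    exact: compact_finite_measure.
  by have /integrableP[_] := iA.
have jump a b : lebesgue_pt m a -> lebesgue_pt m b -> a < b ->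
    c * (m b - m a) = \int[mu]_(t in `]a, b]) G t.
  move=> la lb ab.
  have e0 n : 0 < n.+1%:R^-1 :> R by rewrite invr_gt0.
  have idn n := plateau_identity T0 ho ho1 gC mv mm vm bm bg weak (e0 n) (ltW ab).
  have lim1 : (c * \int[mu]_y (m y * dplateau a b n.+1%:R^-1 y)) @[n --> \oo] -->
      c * (m a * step 1 - m b * step 1).
    have H n : \int[mu]_y (m y * dplateau a b n.+1%:R^-1 y) =
        \int[mu]_y (m y * mollifier a n.+1%:R^-1 y) -
        \int[mu]_y (m y * mollifier b n.+1%:R^-1 y).
      have <- := RintegralB measurableT (integrable_mollifierM mm bm a (e0 n))
        (integrable_mollifierM mm bm b (e0 n)).
      by apply: eq_Rintegral => y _; rewrite /dplateau mulrBr.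
    under eq_fun do rewrite H.
    apply: cvgM; first exact: cvg_cst.
    by apply: cvgB; exact: (cvg_mollifier mm bm).
  have lim2 : (- \int[mu]_y (plateau a b n.+1%:R^-1 y * G y)) @[n --> \oo] -->
      - (step 1 * \int[mu]_(y in `]a, b]) G y).
    by apply: cvgN; exact: (cvg_plateau ab mG GK).
  have lim3 : (c * \int[mu]_y (m y * dplateau a b n.+1%:R^-1 y)) @[n --> \oo] -->
      - (step 1 * \int[mu]_(y in `]a, b]) G y).
    by under eq_fun do rewrite idn.
  have := cvg_unique _ lim1 lim3 => /(_ (@norm_hausdorff _ _)) E.
  apply: (mulfI (lt0r_neq0 (@step1_gt0 R))).
  by rewrite -[RHS]opprK -E; ring.
have [w [wP wI]] := profile_of_jumps c0 mG GK lm jump.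
have wm : {ae mu, forall x, w x = m x}.
  by apply: filterS lm; [exact: (ae_filter_ringOfSetsType mu)|exact: wP].
have wlip := lipschitz_of_increments mG GK wI.
have wb x : `|w x| <= M + `|c^-1| * K.
  have [y Py xy] := ae_dense lm x ltr01.
  rewrite -(subrK (w y) (w x)) addrC; apply: le_trans (ler_normD _ _) _.
  rewrite wP// lerD//; rewrite -(wP _ Py); apply: le_trans (wlip _ _) _.
  apply: ler_piMr; last exact: ltW.
  by rewrite mulr_ge0//; exact: le_trans (GK 0).
have lw : lip_family (fun _ => w).
  split; first by exists (`|c^-1| * K) => _; exact: wlip.
    by exists (M + `|c^-1| * K) => _; exact: wb.
  by move=> y; exact: cst_continuous.
have mw : measurable_fun setT w.
  exact: continuous_measurable_fun (lipschitz_continuous wlip).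
exists w; split => //.
  apply: filterS2 wm vm; first exact: (ae_filter_ringOfSetsType mu).
  by move=> x -> ->.
have gloc : Ck1_loc 0 (fun p => g p.1 p.2).
  split => //; apply: lipschitz_locally_lip.
  by move=> a b a' b'; exact: gC.
have [[[L HL] [K' HK'] _] _] : Ck1_family 0 (fun _ => nonlocal_flux kap g w).
  exact: Ck1_family_nonlocal_flux.
have Gw := ae_eq_nonlocal_flux gC mk mm mw wm.
have mGw : measurable_fun setT (nonlocal_flux kap g w).
  exact: continuous_measurable_fun (lipschitz_continuous (HL 0)).
apply: (is_derive_of_increments (HK' 0) (HL 0)) => x y xy.
apply: etrans (wI _ _ xy) _; apply: (congr1 ( *%R c^-1)).
apply: ae_eq_Rintegral => //; try exact: measurable_funTS.
apply: filterS Gw; first exact: (ae_filter_ringOfSetsType mu).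
by move=> z ->.
Qed.

End lipschitz_profile.

(** * Regularity of traveling waves *)

Theorem theorem2p5 (R : realType) (T delta : R) (hT : 0 < T) (hdelta : 0 < delta)
  (omega : R -> R) (homega : kernel_of_horizon delta omega)
  (f : R -> R) (g : R -> R -> R) (hgf : consistent g f)
  (hgm : monotone_flux g) (hgL : lipschitz_flux g)
  (homega1 : (\int[@lebesgue_measure R]_(h in `[0%R, delta]) (omega h / h)%:E < +oo)%E)
  (v : R -> R) (c : R)
  (hu : weak_solution T delta omega g v (traveling_wave v c)) :
  c = 0 \/
  exists u' : R * R -> R,
    {ae (@lebesgue_measure R \x @lebesgue_measure R)%E,
       forall p, strip T p -> u' p = traveling_wave v c p} /\
    forall k : nat, Ck1 [set: R * R] k (fun p => g p.1 p.2) ->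
      Ck1 (strip T) k.+1 u'.
Proof.
have [->|c0] := eqVneq c 0; [by left|right].
have [mv [w [lw wv dw]]] := lipschitz_traveling_profile hT c0 homega homega1 hgL hu.
exists (fun p => w (p.1 - c * p.2)); split; last first.
  move=> k gk; apply: Ck1_travel.
  apply: (profile_Ck1 _ (Ck1_loc_of_Ck1 gk) lw dw).
  exact: integrable_weighted_kernel.
have mw : measurable_fun setT w.
  have [[L HL] _ _] := lw.
  exact: continuous_measurable_fun (lipschitz_continuous (HL 0)).
(* the set of exceptions is measurable, so that its trace on the strip is null *)
pose Z := [set x | w x != v x].
have mZ : measurable Z.
  rewrite (_ : Z = (fun x => w x - v x) @^-1` (~` [set 0])); last first.
    by apply/seteqP; split => x /=; [move/eqP => H /eqP; rewrite subr_eq0 => /eqP|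
      move=> H; apply/eqP => E; apply: H; rewrite E subrr].
  have mB : measurable_fun setT (fun x => w x - v x) by exact: measurable_funB.
  by rewrite -[X in measurable X]setTI; apply: mB => //; exact: measurableC.
have Z0 : lebesgue_measure Z = 0%E.
  have [N [mN N0 HN]] := wv.
  apply: (subset_measure0 _ mN _ N0); first exact: mZ.
  by move=> x /eqP H; exact: HN.
have [N [mN N0 HN]] := (strip_line_null c hT mZ).2 Z0.
exists N; split => // p /= Hp; apply: HN.
have [sp|nsp] := pselect (strip T p); last by exfalso; apply: Hp.
by split => //=; apply/eqP => E; apply: Hp.
Qed.
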